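(* Let $\xi\in\mathbb R$. Consider $w_r(\xi,\cdot)$ as a function of $\zeta>0$ alone and $v(\xi,\cdot)$ as a distribution of $\zeta>0$ alone. Then $$\lim_{r\to\infty} w_r(\xi,\cdot)\,\mathbf 1_{(0,\infty)} = v(\xi,\cdot)\,\mathbf 1_{(0,\infty)}\qquad\text{in }\mathcal S'(\mathbb R).$$ If $w_r(\xi,\zeta)$ is given for all $\zeta\in\mathbb R$ by $w_r(\xi,\zeta)=w_r(\xi,|\zeta|)$, then $\lim_{r\to\infty} w_r(\xi,\cdot)=v(\xi,|\cdot|)$ in $\mathcal S'(\mathbb R)$.
   Context: For real $r>0$, $\xi\in\mathbb R$ and $\zeta\ge 0$, set $$w_r(\xi,\zeta)=e^{-2\pi i r^2\zeta}\sum_{n\in\mathbb Z} e^{2\pi i r^2\sqrt{1-(n/r)^2}\,\zeta}\,e^{2\pi i n\xi},$$ with the convention $\sqrt{1-(n/r)^2}=i\sqrt{(n/r)^2-1}$ when $|n|>r$ (so those terms carry the decaying factor $e^{-2\pi r^2\sqrt{(n/r)^2-1}\,\zeta}$). Let $$v(\xi,\zeta)=\sum_{n\in\mathbb Z}e^{2\pi i n\xi-i\pi n^2\zeta},$$ understood for fixed $\xi$ as a tempered distribution in the variable $\zeta$: $\langle v(\xi,\cdot),\varphi\rangle=\sum_{n\in\mathbb Z}e^{2\pi i n\xi}\,\widehat\varphi(n^2/2)$ for $\varphi\in\mathcal S(\mathbb R)$, where $\widehat\varphi(x)=\int_{\mathbb R}\varphi(\zeta)e^{-2\pi i x\zeta}\,d\zeta$.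 Correspondingly, $$\langle v(\xi,\cdot)\mathbf 1_{(0,\infty)},\varphi\rangle=\sum_{n\in\mathbb Z}e^{2\pi i n\xi}\int_0^\infty\varphi(\zeta)e^{-i\pi n^2\zeta}\,d\zeta,\qquad \langle v(\xi,|\cdot|),\varphi\rangle=\sum_{n\in\mathbb Z}e^{2\pi i n\xi}\int_{\mathbb R}\varphi(\zeta)e^{-i\pi n^2|\zeta|}\,d\zeta .$$ Functions act on $\varphi\in\mathcal S(\mathbb R)$ by integration against $\varphi$. $\mathbf 1_A$ denotes the characteristic function of $A$. Convergence $T_r\to T$ in $\mathcal S'(\mathbb R)$ means $\langle T_r,\varphi\rangle\to\langle T,\varphi\rangle$ for every $\varphi\in\mathcal S(\mathbb R)$.
   Formalization: For integer ξ, w_r(ξ,ζ) behaves like 1/(πrζ) near ζ=0, so its integral against φ with φ(0)≠0 diverges; both limits are asserted for φ whose product with w_r is integrable for large r, shown to hold for all φ if ξ is not an integer and for φ(0)=0 otherwise. *)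

(* Defs.v *)
From HB Require Import structures.
From mathcomp Require Import all_boot all_order all_algebra.
From mathcomp Require Import all_classical all_reals all_analysis.
From mathcomp.real_closed Require Import complex.

Set Implicit Arguments.
Unset Strict Implicit.
Unset Printing Implicit Defensive.

Import Order.TTheory GRing.Theory Num.Theory.
Import numFieldNormedType.Exports.

Local Open Scope classical_set_scope.
Local Open Scope ring_scope.
Local Open Scope complex_scope.

Section Defs.
Context {R : realType}.
Implicit Types (f phi : R -> R[i]) (r xi zeta : R).

Definition cexp (z : R[i]) : R[i] :=
  (expR (complex.Re z))%:C * (cos (complex.Im z) +i* sin (complex.Im z)).

(* The square root of a real number, with the convention
   sqrt x = i sqrt (- x) for x < 0. *)
Definition csqrt (x : R) : R[i] :=
  if 0 <= x then (Num.sqrt x)%:C else 'i%C * (Num.sqrt (- x))%:C.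

(* [R[i]^o] is [R[i]] with the topology given by the modulus. Both halves of the
   two-sided series, over n >= 0 and over n < 0, are summed separately; every
   series to which this is applied below is absolutely convergent, except that
   of [w] at zeta <= 0, which is irrelevant for the integrals. *)
Definition sumZ (a : int -> R[i]) : R[i] :=
  lim ((\sum_(0 <= n < N) a n%:Z : R[i]^o) @[N --> \oo]) +
  lim ((\sum_(0 <= n < N) a (- n.+1%:Z) : R[i]^o) @[N --> \oo]).

Definition cintegrable (D : set R) f : Prop :=
  (@lebesgue_measure R).-integrable D (fun x => (complex.Re (f x))%:E) /\
  (@lebesgue_measure R).-integrable D (fun x => (complex.Im (f x))%:E).

Definition cintegral (D : set R) f : R[i] :=
  (\int[@lebesgue_measure R]_(x in D) complex.Re (f x)) +i*
  (\int[@lebesgue_measure R]_(x in D) complex.Im (f x)).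

Definition schwartzR (g : R -> R) : Prop :=
  (forall m x, derivable (derive1n m g) x 1) /\
  (forall k m : nat, exists C : R, forall x, `|x ^+ k * derive1n m g x| <= C).

(* Schwartz space of complex-valued functions of a real variable. *)
Definition schwartz phi : Prop :=
  schwartzR (fun x => complex.Re (phi x)) /\
  schwartzR (fun x => complex.Im (phi x)).

(* The action of a function on a test function by integration is meaningful only
   when their product is integrable; otherwise [pairing] is a junk value. *)
Definition pairable f phi : Prop := cintegrable setT (fun x => f x * phi x).

Definition pairing f phi : R[i] := cintegral setT (fun x => f x * phi x).

Definition w r xi zeta : R[i] :=
  cexp (- ('i%C * (2 * pi * r ^+ 2 * zeta)%:C)) *
  sumZ (fun n : int =>
    cexp ('i%C * (2 * pi * r ^+ 2)%:C * csqrt (1 - (n%:~R / r) ^+ 2) * zeta%:C) *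
    cexp ('i%C * (2 * pi * n%:~R * xi)%:C)).

Definition w_pos r xi zeta : R[i] := w r xi zeta * (\1_(`]0, +oo[) zeta)%:C.

Definition w_even r xi zeta : R[i] := w r xi `|zeta|.

Definition v_pos xi phi : R[i] :=
  sumZ (fun n : int => cexp ('i%C * (2 * pi * n%:~R * xi)%:C) *
    cintegral `]0, +oo[
      (fun zeta => phi zeta * cexp (- ('i%C * (pi * n%:~R ^+ 2 * zeta)%:C)))).

Definition v_even xi phi : R[i] :=
  sumZ (fun n : int => cexp ('i%C * (2 * pi * n%:~R * xi)%:C) *
    cintegral setT
      (fun zeta => phi zeta * cexp (- ('i%C * (pi * n%:~R ^+ 2 * `|zeta|)%:C)))).

End Defs.

(* Main.v *)
Require Import Defs.
From HB Require Import structures.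
From mathcomp Require Import all_boot all_order all_algebra.
From mathcomp Require Import all_classical all_reals all_analysis.
From mathcomp Require Import measurable_realfun.
From mathcomp Require Import ring lra.
From mathcomp.real_closed Require Import complex.

Import Order.TTheory GRing.Theory Num.Theory.
Import numFieldNormedType.Exports.

Local Open Scope classical_set_scope.
Local Open Scope ring_scope.
Local Open Scope complex_scope.

(** With [e(t) = exp (2 i pi t)], write the [n]-th term of [w r xi zeta] as
[e(n xi) exp ((- a_n + i b_n) zeta)], where [a_n >= 0] and [b_n] depend on [|n|] and
[r]. For [|n| <= r] there is no damping and [b_n = 2 pi r ^ 2 (sqrt (1 - (n / r) ^ 2) - 1)]
tends to [- pi n ^ 2] as [r] grows, so the terms of [w] converge to those of
[v]; only the interchange of limit and sum has to be justified.

One integration by parts bounds the pairing of a Schwartz function with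
[exp ((- a + i b) zeta)] on the positive half line by [K / |b|], uniformly in
[a >= 0] ([oscillatory_bound]). Since [|b_n| >= pi n ^ 2] for [|n| <= r], the pairings
with the propagating modes are dominated by a convergent series independent of
[r]. The evanescent modes [|n| > r] all have [b_n = - 2 pi r ^ 2], so their sum is
an oscillation times a real amplitude, and [a_n >= 2 pi r (|n| - r)].
The first of them is again handled by integration by parts. The sum of the
others is at most [1 / (pi r zeta)] ([rest_inv_bound]), hence tends to 0 for
fixed [zeta > 0]. Multiplied by the test function it is dominated uniformly in
[r >= 1]: if [xi] is not an integer it is bounded, by Abel summation
([rest_bounded]); if the test function vanishes at 0, this compensates
[1 / zeta]. This gives both integrability and convergence in these two cases
([wave_integral], [wave_integral_cvg]).

In the remaining case, [xi] is an integer and the test function does not vanish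
at 0; then the evanescent amplitude is at least [c / zeta] near 0 and the
product is not integrable ([wave_not_integrable]), so that the hypothesis of
pairability excludes this case.

Real and imaginary parts are treated together by a phase [th], and the two-sided
sums are folded into one-sided sums with real weights ([sumZ_weight]). The even
extension reduces to the half line: pairing with [w r xi |zeta|] is the sum of the
half-line pairings with [phi] and with its reflection. *)

(** * Integration over the positive half line *)

Section RealIntegration.
Set Implicit Arguments.
Unset Strict Implicit.
Context {R : realType}.
Implicit Types (f g h : R -> R) (x : R).
Notation mu := (@lebesgue_measure R).

Lemma integrable_dominated (D : set R) f g : measurable D ->
  measurable_fun D f -> mu.-integrable D (EFin \o g) ->
  (forall x, D x -> `|f x| <= g x) -> mu.-integrable D (EFin \o f).
Proof.
move=> mD mf ig fg; apply: le_integrable ig => //.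
  exact/measurable_EFinP.
by move=> x Dx /=; rewrite lee_fin (le_trans (fg x Dx))// ler_norm.
Qed.

Lemma measurable_integrable (D : set R) f :
  mu.-integrable D (EFin \o f) -> measurable_fun D f.
Proof. by move=> /measurable_int /measurable_EFinP. Qed.

Lemma integrable_scale (D : set R) (k : R) f : measurable D ->
  mu.-integrable D (EFin \o f) -> mu.-integrable D (EFin \o (fun x => k * f x)).
Proof. by move=> mD; exact: integrableZl. Qed.

Lemma integrable_add (D : set R) f g : measurable D ->
  mu.-integrable D (EFin \o f) -> mu.-integrable D (EFin \o g) ->
  mu.-integrable D (EFin \o (fun x => f x + g x)).
Proof. by move=> mD; exact: integrableD. Qed.

Lemma integrable_sub (D : set R) f g : measurable D ->
  mu.-integrable D (EFin \o f) -> mu.-integrable D (EFin \o g) ->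
  mu.-integrable D (EFin \o (fun x => f x - g x)).
Proof. by move=> mD; exact: integrableB. Qed.

Lemma integrable_mul_bounded (D : set R) f g (M : R) : measurable D ->
  mu.-integrable D (EFin \o f) -> measurable_fun D g ->
  (forall x, D x -> `|g x| <= M) ->
  mu.-integrable D (EFin \o (fun x => f x * g x)).
Proof.
move=> mD fi mg gM; have fi' := integrable_norm fi.
apply: integrable_dominated (integrable_scale M _ fi') _ => //.
  by apply: measurable_funM => //; exact: measurable_integrable.
by move=> x Dx; rewrite normrM mulrC ler_wpM2r// gM.
Qed.

(** Dominated convergence for real-valued integrals along a sequence. *)
Lemma Rintegral_dominated_cvg (D : set R) (u : nat -> R -> R) f g :
  measurable D ->
  (forall n, measurable_fun D (u n)) -> mu.-integrable D (EFin \o g) ->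
  (forall n x, D x -> `|u n x| <= g x) ->
  (forall x, D x -> u ^~ x @ \oo --> f x) ->
  \int[mu]_(x in D) u n x @[n --> \oo] --> \int[mu]_(x in D) f x.
Proof.
move=> mD mu_ ig ug uf.
have mf : measurable_fun D f by apply: (measurable_fun_cvg mu_).
have [||||intf _ cvgf] := @dominated_convergence _ _ R mu D mD
  (fun n x => (u n x)%:E) (EFin \o f) (EFin \o g) _ _ _ ig.
- by move=> n; apply/measurable_EFinP; exact: mu_.
- exact/measurable_EFinP.
- apply/aeW => x Dx /=; apply: cvg_EFin; first exact: nearW.
  exact: uf.
- by apply/aeW => x n Dx /=; rewrite lee_fin ug.
apply: (fine_cvg (f := fun n => (\int[mu]_(x in D) (u n x)%:E)%E)).
by rewrite fineK//; exact: integrable_fin_num.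
Qed.

Lemma integrable_oneDsqrV (C : R) :
  mu.-integrable `]0, +oo[ (EFin \o (fun x => C * (1 + x ^+ 2)^-1)).
Proof.
suff : mu.-integrable `]0, +oo[ (EFin \o (fun x => (oneDsqr x)^-1)).
  by move=> iV; exact: integrable_scale.
have m (D : set R) : measurable_fun D (fun x => ((oneDsqr x)^-1)%:E).
  apply/measurable_EFinP; apply: measurable_funTS.
  by apply: continuous_measurable_fun; exact: continuous_oneDsqrV.
suff : mu.-integrable `[0, +oo[ (EFin \o (fun x => (oneDsqr x)^-1)).
  apply: integrableS => //.
  by apply: subset_itvr; rewrite bnd_simp.
apply/integrableP; split; first exact: m.
apply: (@le_lt_trans _ _ (pi / 2)%:E); last exact: ltry.
rewrite -integral0y_oneDsqr le_eqVlt; apply/orP; left; apply/eqP.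
by apply: eq_integral => x _ /=; rewrite ger0_norm// invr_ge0 (le_trans ler01)// oneDsqr_ge1.
Qed.

Lemma integrable_decay f (C : R) : measurable_fun (`]0, +oo[ : set R) f ->
  (forall x, 0 < x -> `|f x| <= C * (1 + x ^+ 2)^-1) ->
  mu.-integrable `]0, +oo[ (EFin \o f).
Proof.
move=> mf fC; apply: integrable_dominated (integrable_oneDsqrV C) _ => //.
by move=> x /=; rewrite in_itv/= andbT; exact: fC.
Qed.

Lemma cvg_decay f (C : R) : (forall x, 0 < x -> `|f x| <= C * (1 + x ^+ 2)^-1) ->
  f n.+1%:R @[n --> \oo] --> (0:R).
Proof.
move=> fC; apply/norm_cvg0P.
have h : `|C| * @harmonic R n @[n --> \oo] --> (0:R).
  by rewrite -[X in _ --> X](mulr0 `|C|); apply: cvgMr; exact: cvg_harmonic.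
apply: (squeeze_cvgr _ (cvg_cst 0) h); near=> n.
rewrite normr_ge0/= (le_trans (fC _ _)) ?ltr0n//.
rewrite (@le_trans _ _ (`|C| * (1 + n.+1%:R ^+ 2)^-1))//.
  by rewrite ler_wpM2r ?ler_norm// invr_ge0 addr_ge0 ?sqr_ge0.
rewrite ler_wpM2l// lef_pV2 ?posrE ?ltr0n ?ltr_pwDl ?sqr_ge0//.
have : 0 <= (n.+1%:R - 1) ^+ 2 :> R by exact: sqr_ge0.
have : 1 <= n.+1%:R :> R by rewrite ler1n.
by nra.
Unshelve. all: by end_near. Qed.

(** A primitive integrates its derivative over the half line. *)
Lemma Rintegral_derive_half_line (F f : R -> R) (C : R) :
  (forall x, is_derive x 1 F (f x)) -> continuous f ->
  (forall x, 0 < x -> `|F x| <= C * (1 + x ^+ 2)^-1) ->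
  (forall x, 0 < x -> `|f x| <= C * (1 + x ^+ 2)^-1) ->
  \int[mu]_(x in `]0, +oo[) f x = - F 0.
Proof.
move=> dF cf FC fC.
have mf D : measurable_fun D f.
  by apply: measurable_funTS; exact: continuous_measurable_fun.
have cF : continuous F.
  move=> x; apply: differentiable_continuous; apply/derivable1_diffP.
  by have := dF x.
have FTC n : \int[mu]_(x in `]0, +oo[) (f \_ `]0, n.+1%:R]) x
    = F n.+1%:R - F 0.
  have H : (\int[mu]_(x in `[0%R, n.+1%:R]) (f x)%:E)%E = (F n.+1%:R - F 0)%:E.
    rewrite EFinB; apply: continuous_FTC2 => //.
    - exact: continuous_subspaceT.
    - split; first by move=> x _.
        exact/cvg_at_right_filter/cF.
      exact/cvg_at_left_filter/cF.
    - by move=> x _; rewrite derive1E; exact: (@derive_val _ _ _ _ _ _ _ (dF x)).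
  rewrite -Rintegral_mkcondr -[RHS]/(fine (F n.+1%:R - F 0)%:E) -H.
  rewrite -integral_itv_obnd_cbnd; last exact/measurable_EFinP.
  congr fine; congr integral; apply/seteqP; split => x /=; rewrite !in_itv/=.
    by case.
  by move=> /andP[-> ->].
have L : \int[mu]_(x in `]0, +oo[) (f \_ `]0, n.+1%:R]) x @[n --> \oo]
    --> \int[mu]_(x in `]0, +oo[) f x.
  apply: (@Rintegral_dominated_cvg _ _ _ (fun x => C * (1 + x ^+ 2)^-1)) => //.
  - move=> n; rewrite patch_indic; apply: measurable_funM => //.
  - exact: integrable_oneDsqrV.
  - move=> n x /=; rewrite in_itv/= andbT => x0.
    rewrite patchE; case: ifPn => _; first exact: fC.
    by rewrite normr0; exact: le_trans (fC x x0).
  - move=> x /=; rewrite in_itv/= andbT => x0.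
    apply: cvg_near_cst; near=> n.
    rewrite patchE mem_set//= in_itv/= x0/=.
    rewrite (@le_trans _ _ n%:R) ?ler_nat//.
    by near: n; exact: nbhs_infty_ger.
rewrite (_ : (fun n => _) = (fun n => F n.+1%:R - F 0)) in L; last first.
  by apply/funext => n; exact: FTC.
have L2 : F n.+1%:R - F 0 @[n --> \oo] --> 0 - F 0.
  by apply: cvgB; [exact: cvg_decay FC|exact: cvg_cst].
by rewrite -[RHS]add0r; exact: (cvg_unique _ L L2).
Unshelve. all: by end_near. Qed.

End RealIntegration.

(** * Reflection of the line *)

Section Reflection.
Set Implicit Arguments.
Unset Strict Implicit.
Context {R : realType}.
Implicit Types (f g h : R -> R) (x : R).
Notation mu := (@lebesgue_measure R).

Lemma integrable_reflect f : mu.-integrable setT (EFin \o f) ->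
  mu.-integrable setT (EFin \o (fun x => f (- x))).
Proof.
move=> fi; have mf := measurable_integrable fi.
have mfN : measurable_fun setT (fun x => f (- x)).
  by apply: (measurableT_comp mf); exact: oppr_measurable.
apply/integrableP; split; first exact/measurable_EFinP.
have /integrableP[_] := fi; apply: le_lt_trans.
rewrite le_eqVlt; apply/orP; left; apply/eqP.
rewrite [RHS](_ : _ = \int[pushforward mu (-%R : _ -> measurableTypeR R)]_x
    `|(EFin \o f) x|)%E; last first.
  by apply: eq_measure_integral => //= A mA AS; exact/esym/lebesgue_measureN.
rewrite ge0_integral_pushforward//=.
by apply/measurable_EFinP; apply: measurableT_comp.
Qed.

Lemma Rintegral_reflect f : mu.-integrable setT (EFin \o f) ->
  \int[mu]_x f (- x) = \int[mu]_x f x.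
Proof.
move=> fi; have mf := measurable_integrable fi.
rewrite /Rintegral; congr fine.
rewrite [RHS](_ : _ = \int[pushforward mu (-%R : _ -> measurableTypeR R)]_x
    (EFin \o f) x)%E; last first.
  by apply: eq_measure_integral => //= A mA AS; exact/esym/lebesgue_measureN.
rewrite integral_pushforward//=.
  by apply/measurable_EFinP.
exact: integrable_reflect.
Qed.

Lemma integrable_halfP f : mu.-integrable `]0, +oo[ (EFin \o f) <->
  mu.-integrable setT (EFin \o (fun x => f x * \1_(`]0, +oo[) x)).
Proof.
rewrite (_ : (fun x => _) = f \_ `]0, +oo[); last by rewrite patch_indic.
rewrite -restrict_EFin; exact: integrable_mkcond.
Qed.

Lemma Rintegral_halfE f : \int[mu]_(x in `]0, +oo[) f x =
  \int[mu]_x (f x * \1_(`]0, +oo[) x).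
Proof. by rewrite Rintegral_mkcond patch_indic. Qed.

Lemma indic_halfE x : \1_(`]0, +oo[) x = (0 < x)%R%:R :> R.
Proof. by rewrite indicE mem_setE in_itv/= andbT. Qed.

Let integrable_point : mu.-integrable setT (EFin \o (\1_([set 0]) : R -> R)).
Proof. by rewrite -set_itv1; exact: integrable_indic_itv. Qed.

Let splitE f x : f x = f x * \1_(`]0, +oo[) x +
   f (- - x) * \1_(`]0, +oo[) (- x) + f 0 * \1_([set 0]) x.
Proof.
rewrite !indic_halfE opprK oppr_gt0 indicE.
case: (ltgtP x 0) => [x0|x0|->]; last first.
- by rewrite mem_set//= !mulr0 !add0r mulr1.
- by rewrite memNset/= ?mulr1 ?mulr0 ?addr0// => /eqP; rewrite gt_eqF.
- by rewrite memNset/= ?mulr1 ?mulr0 ?addr0 ?add0r// => /eqP; rewrite lt_eqF.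
Qed.

(** Integrability over the line is integrability over the two open half lines,
both written over the positive one; the origin is negligible. *)
Lemma integrable_splitP f : mu.-integrable setT (EFin \o f) <->
  mu.-integrable `]0, +oo[ (EFin \o f) /\
  mu.-integrable `]0, +oo[ (EFin \o (fun x => f (- x))).
Proof.
split=> [fi|[fp fn]].
  split; first exact: integrableS fi.
  by apply: integrableS (integrable_reflect fi).
rewrite (_ : f = fun x => f x * \1_(`]0, +oo[) x +
   f (- - x) * \1_(`]0, +oo[) (- x) + f 0 * \1_([set 0]) x); last first.
  by apply/funext => x; exact: splitE.
apply: integrable_add; rewrite //; last exact: integrable_scale.
apply: integrable_add => //.
  exact/integrable_halfP.
exact: (integrable_reflect ((integrable_halfP (fun x => f (- x))).1 fn)).
Qed.

Lemma Rintegral_split f : mu.-integrable setT (EFin \o f) ->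
  \int[mu]_x f x =
  \int[mu]_(x in `]0, +oo[) f x + \int[mu]_(x in `]0, +oo[) f (- x).
Proof.
move=> /[dup] fi /integrable_splitP[/integrable_halfP fp /integrable_halfP fn].
rewrite 2!Rintegral_halfE -(Rintegral_reflect fn).
transitivity (\int[mu]_x (f x * \1_(`]0, +oo[) x +
   f (- - x) * \1_(`]0, +oo[) (- x) + f 0 * \1_([set 0]) x)).
  by apply: eq_Rintegral => x _; exact: splitE.
have fn' := integrable_reflect fn.
rewrite RintegralD//; [|exact: integrable_add|exact: integrable_scale].
rewrite RintegralD//= RintegralZl//.
rewrite (_ : \int[mu]_x \1_[set 0] x = 0) ?mulr0 ?addr0//.
rewrite /Rintegral integral_indic//= setIT.
by rewrite [X in fine X](_ : _ = 0%E)// lebesgue_measure_set1.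
Qed.

End Reflection.

(** * Oscillatory integrals *)

Section OscillatoryIntegrals.
Set Implicit Arguments.
Unset Strict Implicit.
Context {R : realType}.
Implicit Types (f g h : R -> R) (x a b th : R).
Notation mu := (@lebesgue_measure R).

(** The only consequences of membership in the Schwartz space that matter below:
[g] is continuously differentiable with derivative [g'], and both are
O(1 / (1 + x ^ 2)). This class is stable under reflection. *)
Definition C1_decay g g' := exists C, [/\ forall x, is_derive x 1 g (g' x),
  continuous g', forall x, `|g x| <= C * (1 + x ^+ 2)^-1 &
  forall x, `|g' x| <= C * (1 + x ^+ 2)^-1].

Lemma decay_ge0 g (C : R) : (forall x, `|g x| <= C * (1 + x ^+ 2)^-1) -> 0 <= C.
Proof.
move=> gC; have := le_trans (normr_ge0 _) (gC 0).
by rewrite expr0n/= addr0 invr1 mulr1.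
Qed.

Lemma schwartzR_C1_decay g : schwartzR g -> C1_decay g (derive1 g).
Proof.
move=> [dg bg].
have decay m : exists C, forall x, `|derive1n m g x| <= C * (1 + x ^+ 2)^-1.
  have [C0 b0] := bg 0%N m; have [C2 b2] := bg 2%N m.
  exists (C0 + C2) => x; rewrite ler_pdivlMr ?ltr_pwDl ?sqr_ge0//.
  rewrite mulrDr mulr1 lerD//; first by have := b0 x; rewrite expr0 mul1r.
  by have := b2 x; rewrite normrM ger0_norm ?sqr_ge0// mulrC.
have [C0 b0] := decay 0%N; have [C1 b1] := decay 1%N.
exists (Num.max C0 C1); split.
- by move=> x; rewrite derive1E; apply: derivableP; exact: (dg 0%N).
- move=> x; apply: differentiable_continuous; apply/derivable1_diffP.
  exact: (dg 1%N).
- move=> x; apply: le_trans (b0 x) _; rewrite ler_wpM2r ?invr_ge0 ?addr_ge0 ?sqr_ge0//.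
  by rewrite le_max lexx.
- move=> x; apply: le_trans (b1 x) _; rewrite ler_wpM2r ?invr_ge0 ?addr_ge0 ?sqr_ge0//.
  by rewrite le_max lexx orbT.
Qed.

Lemma C1_decay_reflect g g' : C1_decay g g' ->
  C1_decay (fun x => g (- x)) (fun x => - g' (- x)).
Proof.
move=> [C [dg cg gC gC']]; exists C; split.
- move=> x; rewrite -[X in is_derive _ _ _ X]mulrN1.
  by apply: (@is_derive1_comp _ g -%R); exact: is_deriveNid.
- move=> x; apply: cvgN; apply: (@continuous_comp _ _ _ -%R g') => //.
    exact: opp_continuous.
  exact: cg.
- by move=> x; rewrite -sqrrN.
- by move=> x; rewrite normrN -sqrrN.
Qed.

Lemma C1_decay_continuous g g' : C1_decay g g' -> continuous g.
Proof.
move=> [C [dg _ _ _]] x; apply: differentiable_continuous.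
by apply/derivable1_diffP; have := dg x.
Qed.

Lemma C1_decay_integrable g g' : C1_decay g g' ->
  mu.-integrable `]0, +oo[ (EFin \o g).
Proof.
move=> gg'; have [C [_ _ gC _]] := gg'.
apply: (@integrable_decay _ _ C) => // ; apply: measurable_funTS.
exact: continuous_measurable_fun (C1_decay_continuous gg').
Qed.

(** The real part of [exp (- a x + i (b x + th))]; the phase [th] treats cosines
([th = 0]) and sines ([th = - pi / 2]) at once. *)
Definition osc a b th x : R := expR (- (a * x)) * cos (b * x + th).

(** A primitive of [osc a b th], bounded by [2 / |b|] on the positive half line. *)
Definition osc_primitive a b th x : R :=
  (a ^+ 2 + b ^+ 2)^-1 *
  (expR (- (a * x)) * (b * sin (b * x + th) - a * cos (b * x + th))).

Lemma is_derive_osc_primitive a b th x : b != 0 ->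
  is_derive x 1 (osc_primitive a b th) (osc a b th x).
Proof.
move=> b0.
have d1 : is_derive x 1 (fun x => - (a * x)) (- a).
  have -> : (fun x => - (a * x)) = (fun x => (- a) * x) by apply/funext => y; ring.
  by apply: is_derive_eq; rewrite /GRing.scale/= mulr1.
have d2 : is_derive x 1 (fun x => b * x + th) b.
  by apply: is_derive_eq; rewrite /GRing.scale/= mulr1 addr0.
have d3 := @is_derive1_comp _ (expR : R -> R) _ x _ _ (is_derive_expR _) d1.
have d4 := @is_derive1_comp _ (sin : R -> R) _ x _ _ (is_derive_sin _) d2.
have d5 := @is_derive1_comp _ (cos : R -> R) _ x _ _ (is_derive_cos _) d2.
rewrite /osc_primitive.
have := @is_deriveM _ _ _ _ x 1 _ _ d3 (is_deriveB (is_deriveZ b d4) (is_deriveZ a d5)).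
move=> /(is_deriveZ (a ^+ 2 + b ^+ 2)^-1) d6.
apply: is_derive_eq d6 _; rewrite /osc /GRing.scale/=.
have ab : a ^+ 2 + b ^+ 2 != 0.
  by rewrite gt_eqF// ltr_wpDl ?sqr_ge0// exprn_even_gt0.
rewrite !fctE /= /GRing.scale /=; by field.
Qed.

Lemma norm_osc_le a b th x : 0 <= a -> 0 <= x -> `|osc a b th x| <= 1.
Proof.
move=> a0 x0; rewrite /osc normrM ger0_norm ?expR_ge0//.
by rewrite mulr_ile1 ?expR_ge0// ?cos_max// ?expR_le1 ?oppr_le0 ?mulr_ge0.
Qed.

Lemma norm_osc_primitive_le a b th x : 0 <= a -> b != 0 -> 0 <= x ->
  `|osc_primitive a b th x| <= 2 / `|b|.
Proof.
move=> a0 b0 x0; rewrite /osc_primitive.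
have ab : 0 < a ^+ 2 + b ^+ 2 by rewrite ltr_wpDl ?sqr_ge0// exprn_even_gt0.
rewrite normrM gtr0_norm ?invr_gt0// mulrC ler_pdivrMr// normrM.
rewrite (@le_trans _ _ (`|b| + a))//; last first.
  have bb : 0 < `|b| by rewrite normr_gt0.
  rewrite mulrAC ler_pdivlMr// -(real_normK (num_real b)).
  have : 0 <= (a - `|b|) ^+ 2 by exact: sqr_ge0.
  by nra.
rewrite (ger0_norm (expR_ge0 _)) -[leRHS]mul1r ler_pM ?expR_ge0//.
  by rewrite expR_le1 oppr_le0 mulr_ge0.
rewrite (le_trans (ler_normB _ _))// !normrM (ger0_norm a0) lerD//.
  by rewrite ler_piMr// sin_max.
by rewrite ler_piMr// cos_max.
Qed.

Lemma continuous_affine b th : continuous (fun x => b * x + th).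
Proof.
move=> x; apply: cvgD; last exact: cvg_cst.
by apply: cvgMr; exact: cvg_id.
Qed.

Lemma continuous_osc a b th : continuous (osc a b th).
Proof.
move=> x; apply: cvgM.
  apply: (@continuous_comp _ _ _ (fun x => - (a * x)) expR) => //; last exact: continuous_expR.
  by apply: cvgN; apply: cvgMr; exact: cvg_id.
apply: (@continuous_comp _ _ _ (fun x => b * x + th) cos); last exact: continuous_cos.
exact: continuous_affine.
Qed.

Lemma continuous_osc_primitive a b th : b != 0 -> continuous (osc_primitive a b th).
Proof.
move=> b0 x; apply: differentiable_continuous; apply/derivable1_diffP.
by have := is_derive_osc_primitive a th x b0.
Qed.

Lemma integrable_mul_osc g a b th : 0 <= a ->
  mu.-integrable `]0, +oo[ (EFin \o g) ->
  mu.-integrable `]0, +oo[ (EFin \o (fun x => g x * osc a b th x)).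
Proof.
move=> a0 gi; apply: (@integrable_mul_bounded _ _ _ _ 1) => //.
  apply: measurable_funTS; apply: continuous_measurable_fun; exact: continuous_osc.
by move=> x /=; rewrite in_itv/= andbT => /ltW; exact: norm_osc_le.
Qed.

(** One integration by parts against [osc_primitive]. The bound is uniform in the
damping [a >= 0], so it serves propagating and evanescent modes alike. *)
Lemma oscillatory_bound g g' : C1_decay g g' -> exists2 K, 0 <= K &
  forall a b th, 0 <= a -> b != 0 ->
  `|\int[mu]_(x in `]0, +oo[) (g x * osc a b th x)| <= K / `|b|.
Proof.
move=> gg'; have [C [dg cg' gC gC']] := gg'.
have cg := C1_decay_continuous gg'; have gi := C1_decay_integrable gg'.
pose I := \int[mu]_(x in `]0, +oo[) (C * (1 + x ^+ 2)^-1).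
have C0 := decay_ge0 gC.
have CV0 x : 0 <= C * (1 + x ^+ 2)^-1 by rewrite mulr_ge0// invr_ge0 addr_ge0// sqr_ge0.
have I0 : 0 <= I by apply: Rintegral_ge0.
exists (2 * (`|g 0| + I)); first by rewrite mulr_ge0// addr_ge0.
move=> a b th a0 b0.
set A := osc_primitive a b th.
have bA x : 0 <= x -> `|A x| <= 2 / `|b| by exact: norm_osc_primitive_le.
have cA : continuous A by exact: continuous_osc_primitive.
have mg'A : measurable_fun (`]0, +oo[ : set R) (fun x => g' x * A x).
  apply: measurable_funTS; apply: continuous_measurable_fun => x; apply: cvgM.
    exact: cg'.
  exact: cA.
have g'Ai : mu.-integrable `]0, +oo[ (EFin \o (fun x => g' x * A x)).
  apply: (@integrable_decay _ _ (2 / `|b| * C)) => // x /ltW x0.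
  rewrite normrM mulrC -[leRHS]mulrA ler_pM// ?bA//.
have goscI := integrable_mul_osc b th a0 gi.
(* The integrand is the derivative of g * A. *)
have E : \int[mu]_(x in `]0, +oo[) (g' x * A x + g x * osc a b th x) = - (g 0 * A 0).
  apply: (@Rintegral_derive_half_line _ (fun x => g x * A x) _ ((2 / `|b| + 1) * C)).
  - move=> x.
    have := @is_deriveM _ _ _ _ x 1 _ _ (dg x) (is_derive_osc_primitive a th x b0).
    by move=> d; apply: is_derive_eq d _; rewrite /GRing.scale/= addrC mulrC.
  - move=> x; apply: cvgD; apply: cvgM; [exact: cg'|exact: cA|exact: cg|exact: continuous_osc].
  - move=> x /ltW x0; rewrite normrM mulrC -[leRHS]mulrA ler_pM//.
    by rewrite (le_trans (bA _ x0))// lerDl.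
  - move=> x /ltW x0; rewrite (le_trans (ler_normD _ _))// (normrM (g' x)) (normrM (g x)).
    rewrite -[leRHS]mulrA mulrDl mul1r lerD//.
      rewrite mulrC ler_pM//.
      exact: bA.
    by rewrite -[leRHS]mulr1 ler_pM// norm_osc_le.
rewrite RintegralD// in E.
have -> : \int[mu]_(x in `]0, +oo[) (g x * osc a b th x) =
   - (g 0 * A 0) - \int[mu]_(x in `]0, +oo[) (g' x * A x) by rewrite -E; ring.
rewrite (le_trans (ler_normB _ _))// normrN normrM.
rewrite mulrDr mulrDl lerD//.
  rewrite mulrC mulrAC ler_wpM2r//.
  by apply: bA.
apply: le_trans (le_normr_Rintegral _ g'Ai) _ => //.
rewrite mulrAC -RintegralZl//; last exact: integrable_oneDsqrV.
apply: le_Rintegral => //.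
- exact: integrable_norm.
- by apply: integrable_scale => //; exact: integrable_oneDsqrV.
- by move=> x /=; rewrite in_itv/= andbT normrM => /ltW x0; rewrite mulrC ler_pM// bA.
Qed.

End OscillatoryIntegrals.

(** * Series *)

Section Series.
Set Implicit Arguments.
Unset Strict Implicit.
Context {R : realType}.
Implicit Types (u v M k c : nat -> R).

Lemma summable_dominated u M : cvgn (series M) -> (forall n, `|u n| <= M n) ->
  cvgn (series u).
Proof.
move=> cM uM; apply: normed_cvg.
by apply: series_le_cvg cM => n //=; exact: le_trans (normr_ge0 _) (uM n).
Qed.

Lemma series_tail_le u M N : cvgn (series M) -> (forall n, `|u n| <= M n) ->
  `|limn (series u) - series u N| <= limn (series M) - series M N.
Proof.
move=> cM uM; have cu := summable_dominated cM uM.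
have M0 n : 0 <= M n by exact: le_trans (normr_ge0 _) (uM n).
have L : `|series u m - series u N| @[m --> \oo] --> `|limn (series u) - series u N|.
  by apply: cvg_norm; apply: cvgB => //; exact: cvg_cst.
rewrite -(cvg_lim _ L)//; apply: limr_le; first by apply/cvg_ex; eexists; exact: L.
near=> m; have Nm : (N <= m)%N by near: m; exact: nbhs_infty_ge.
apply: (@le_trans _ _ (series M m - series M N)); last first.
  rewrite lerD2r; apply: nondecreasing_cvgn_le => //.
  by apply: nondecreasing_series.
by rewrite !sub_series_geq// (le_trans (ler_norm_sum _ _ _))// ler_sum.
Unshelve. all: by end_near. Qed.

Lemma summable_scale (a : R) M : cvgn (series M) -> cvgn (series (fun n => a * M n)).
Proof.
move=> cM; rewrite (_ : (fun n => _) = a *: M); first exact: is_cvg_seriesZ.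
by apply/funext.
Qed.

(** Dominated convergence for series. *)
Lemma series_dominated_cvg (u : nat -> nat -> R) v M : cvgn (series M) ->
  (forall j n, `|u j n| <= M n) -> (forall n, u j n @[j --> \oo] --> v n) ->
  limn (series (u j)) @[j --> \oo] --> limn (series v).
Proof.
move=> cM uM uv.
have vM n : `|v n| <= M n.
  have L : `|u j n| @[j --> \oo] --> `|v n| by exact: cvg_norm (uv n).
  rewrite -(cvg_lim _ L)//; apply: limr_le; first by apply/cvg_ex; eexists; exact: L.
  exact: nearW.
apply/cvgrPdist_lt => e e0.
have e4 : 0 < e / 4 by rewrite divr_gt0.
have [N _ /(_ N (leqnn N)) /= MN] := (cvgrPdist_lt _ _).1 cM _ e4.
have fin m : series (u j) m @[j --> \oo] --> series v m.
  elim: m => [|m IH].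
    rewrite (_ : (fun j => _) = cst (series v 0)); first exact: cvg_cst.
    by apply/funext => j; rewrite /series/= !big_geq.
  rewrite seriesSr (_ : (fun j => _) = (fun j => series (u j) m + u j m)).
    exact: cvgD.
  by apply/funext => j; rewrite seriesSr.
near=> j.
have h1 := series_tail_le N cM (uM j); have h2 := series_tail_le N cM vM.
have h3 : `|series v N - series (u j) N| < e / 4.
  by near: j; exact: ((cvgrPdist_lt _ _).1 (fin N)).
have {}MN : limn (series M) - series M N < e / 4 := le_lt_trans (ler_norm _) MN.
rewrite (_ : _ - _ = (limn (series v) - series v N) +
  (series v N - series (u j) N) - (limn (series (u j)) - series (u j) N)); last by ring.
rewrite (le_lt_trans (ler_normB _ _))//.
have := ler_normD (limn (series v) - series v N) (series v N - series (u j) N).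
by lra.
Unshelve. all: by end_near. Qed.

Lemma summable_inv_sqr (C : R) : cvgn (series (fun n => C * (1 + n%:R ^+ 2)^-1)).
Proof.
suff h : cvgn (series (fun n : nat => (1 + n%:R ^+ 2)^-1 : R)) by exact: summable_scale.
have pos n : 0 < 1 + n%:R ^+ 2 :> R by rewrite ltr_pwDl ?sqr_ge0.
have bnd n : series (fun n : nat => (1 + n%:R ^+ 2)^-1 : R) n <= 4 - 4 / n.+1%:R.
  elim: n => [|n IH]; first by rewrite /series/= big_geq// divr1 subrr.
  rewrite seriesSr (le_trans (lerD IH (lexx _)))//.
  (* Comparison with the telescoping series of 4 / ((n + 1) (n + 2)). *)
  suff : (1 + n%:R ^+ 2)^-1 <= 4 / n.+1%:R - 4 / n.+2%:R :> R.
    by move=> h; rewrite (le_trans (lerD (lexx _) h))// addrA subrK.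
  have -> : 4 / n.+1%:R - 4 / n.+2%:R = 4 / (n.+1%:R * n.+2%:R) :> R.
    have a0 : 0 < n.+1%:R :> R by rewrite ltr0n.
    rewrite -(natr1 n.+1); move: (n.+1%:R) a0 => a a0; field.
    by rewrite !gt_eqF// addr_gt0.
  rewrite ler_pdivlMr ?mulr_gt0 ?ltr0n// mulrC ler_pdivrMr//.
  rewrite -(natr1 n.+1) -(natr1 n).
  have := sqr_ge0 (n%:R - 1 / 2 : R).
  by nra.
apply: nondecreasing_is_cvgn.
  by apply: nondecreasing_series => n _ _; rewrite invr_ge0 ltW.
exists 4 => _ [n _ <-]; rewrite (le_trans (bnd n))//.
by rewrite gerBl divr_ge0.
Qed.

(** Summation by parts against a nonincreasing sequence. *)
Lemma abel_bound k c (C : R) p q : (p <= q)%N -> 0 <= C ->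
  (forall n, (p <= n)%N -> `|\sum_(p <= i < n) k i| <= C) ->
  (forall n, 0 <= c n) -> (forall n, (p <= n)%N -> c n.+1 <= c n) ->
  `|\sum_(p <= i < q) k i * c i| <= C * c p.
Proof.
move=> pq C0 kC c0 cdec.
(* The boundary term is kept so that the induction telescopes. *)
have key : `|\sum_(p <= i < q) k i * c i - (\sum_(p <= i < q) k i) * c q|
    <= C * (c p - c q).
  elim: q pq => [|q IH].
    by rewrite leqn0 => /eqP ->; rewrite !big_geq// mul0r subrr normr0 subrr mulr0.
  rewrite leq_eqVlt ltnS => /predU1P[<-|pq].
    by rewrite !big_geq// mul0r subrr normr0 subrr mulr0.
  have {}IH := IH pq.
  rewrite !(@big_nat_recr _ _ _ q)//=.
  rewrite (_ : _ - _ = (\sum_(p <= i < q) k i * c i - (\sum_(p <= i < q) k i) * c q)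
     + (\sum_(p <= i < q) k i + k q) * (c q - c q.+1)); last by ring.
  rewrite (le_trans (ler_normD _ _))//.
  have h : `|(\sum_(p <= i < q) k i + k q) * (c q - c q.+1)| <= C * (c q - c q.+1).
    rewrite normrM (ger0_norm (_ : 0 <= c q - c q.+1)) ?subr_ge0 ?cdec//.
    rewrite ler_wpM2r ?subr_ge0 ?cdec//.
    by have := kC q.+1 (leqW pq); rewrite big_nat_recr.
  by lra.
have h : `|(\sum_(p <= i < q) k i) * c q| <= C * c q.
  by rewrite normrM (ger0_norm (c0 q)) ler_wpM2r// kC.
rewrite -(subrK ((\sum_(p <= i < q) k i) * c q) (\sum_(p <= i < q) k i * c i)).
rewrite (le_trans (ler_normD _ _))//.
by lra.
Qed.

End Series.

Section CosineSums.
Set Implicit Arguments.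
Unset Strict Implicit.
Context {R : realType}.

(** Reduction to the fractional part, which lies strictly between 0 and 1. *)
Lemma sin_pi_neq0 (xi : R) : xi \isn't a Num.int -> sin (pi * xi) != 0.
Proof.
move=> xiN; pose m := Num.floor xi; pose f := xi - m%:~R.
have f0 : 0 < f.
  rewrite subr_gt0 lt_neqAle floor_le ?andbT//.
  by apply: contra xiN => /eqP <-; exact: intr_int.
have f1 : f < 1 by rewrite ltrBlDl -[1]/(1%:~R) -intrD floorD1_gt.
have sf : 0 < sin (pi * f).
  by apply: sin_gt0_pi; rewrite mulr_gt0 ?pi_gt0//= gtr_pMr ?pi_gt0.
have per (n : nat) (x : R) : `|sin (x + pi * n%:R)| = `|sin x|.
  elim: n x => [|n IH] x; first by rewrite mulr0 addr0.
  by rewrite -natr1 mulrDr mulr1 addrA sinDpi normrN IH.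
suff : `|sin (pi * xi)| = `|sin (pi * f)|.
  by move=> e; rewrite -normr_eq0 e normr_eq0 gt_eqF.
have -> : pi * xi = pi * f + pi * m%:~R by rewrite /f; ring.
case: (intP m) => [|n|n].
- by rewrite mulr0 addr0.
- exact: (per n.+1).
- by rewrite -(per n.+1) mulrNz mulrN subrK.
Qed.

Lemma cos_int (xi : R) n : xi \is a Num.int -> cos (2 * pi * n%:R * xi) = 1.
Proof.
move=> /intrP[m ->].
have per (j : nat) : cos (2 * pi * j%:R) = 1 :> R.
  elim: j => [|j IH]; first by rewrite mulr0 cos0.
  rewrite -(natr1 j) mulrDr mulr1 [2 * pi]mulr_natl cosD2pi -[pi *+ 2]mulr_natl.
  exact: IH.
case: (intP m) => [|j|j].
- by rewrite mulr0 cos0.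
- by rewrite -(mulrA (2 * pi)) -[_%:~R]/(j.+1%:R) -natrM per.
- by rewrite mulrNz mulrN cosN -(mulrA (2 * pi)) -[_%:~R]/(j.+1%:R) -natrM per.
Qed.

(** Multiplying by [sin (pi xi)] makes the sum telescope. *)
Lemma cos_sum_bounded (xi : R) : xi \isn't a Num.int -> exists2 C, 0 <= C &
  forall p q, (p <= q)%N -> `|\sum_(p <= n < q) 2 * cos (2 * pi * n%:R * xi)| <= C.
Proof.
move=> /sin_pi_neq0 s0; set s := sin (pi * xi) in s0 *.
exists (2 / `|s|) => [|p q pq]; first by rewrite divr_ge0.
pose t n := sin ((2 * n%:R - 1) * (pi * xi)).
have E : s * (\sum_(p <= n < q) 2 * cos (2 * pi * n%:R * xi)) = t q - t p.
  rewrite -telescope_sumr// big_distrr/=; apply: eq_bigr => n _.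
  rewrite /t -(natr1 n) (_ : (_ - 1) * (pi * xi) = 2 * pi * n%:R * xi + pi * xi); last by ring.
  rewrite (_ : (2 * n%:R - 1) * (pi * xi) = 2 * pi * n%:R * xi - pi * xi); last by ring.
  by rewrite sinD sinB /s; ring.
rewrite ler_pdivlMr ?normr_gt0// -normrM mulrC E (le_trans (ler_normB _ _))//.
by rewrite -[2]/(1 + 1) lerD// sin_max.
Qed.

End CosineSums.

(** * The modes of the wave *)

Section Modes.
Set Implicit Arguments.
Unset Strict Implicit.
Context {R : realType}.
Implicit Types (r x xi th : R) (n : nat).
Notation mu := (@lebesgue_measure R).

(** The contribution of the indices [n] and [- n] to the two-sided series:
[exp (2 i pi n xi) + exp (- 2 i pi n xi)], counted once for [n = 0]. *)
Definition weight xi n : R := if n == 0%N then 1 else 2 * cos (2 * pi * n%:R * xi).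

(** The exponent of the mode [n] of [w r], that is
[2 pi i r ^ 2 (sqrt (1 - (n / r) ^ 2) - 1)], is [- damp r n + i freq r n].
Propagating modes ([n <= r]) are not damped; evanescent modes ([n > r]) all
oscillate at the same frequency [- 2 pi r ^ 2]. *)
Definition damp r n : R :=
  if n%:R <= r then 0 else 2 * pi * r ^+ 2 * Num.sqrt ((n%:R / r) ^+ 2 - 1).

Definition freq r n : R :=
  if n%:R <= r then 2 * pi * r ^+ 2 * (Num.sqrt (1 - (n%:R / r) ^+ 2) - 1)
  else - (2 * pi * r ^+ 2).

Lemma norm_weight_le xi n : `|weight xi n| <= 2.
Proof.
rewrite /weight; case: ifP => _; first by rewrite normr1 ler1n.
by rewrite normrM ger0_norm// ler_piMr// cos_max.
Qed.

Lemma summable_weight xi (p M : nat -> R) : cvgn (series M) ->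
  (forall n, `|p n| <= M n) -> cvgn (series (fun n => weight xi n * p n)).
Proof.
move=> cM pM; apply: (@summable_dominated _ _ (fun n => 2 * M n)).
  exact: summable_scale.
by move=> n; rewrite normrM ler_pM// norm_weight_le.
Qed.

Lemma damp_ge0 r n : 0 <= damp r n.
Proof.
rewrite /damp; case: ifP => // _.
by rewrite mulr_ge0 ?sqrtr_ge0// mulr_ge0 ?sqr_ge0// mulr_ge0 ?pi_ge0.
Qed.

Let cf r : 0 < r -> 0 < 2 * pi * r ^+ 2.
Proof. by move=> r0; rewrite !mulr_gt0 ?pi_gt0 ?exprn_gt0. Qed.

Lemma damp_ge r n : 0 < r -> 2 * pi * r * (n%:R - r) <= damp r n.
Proof.
move=> r0; rewrite /damp; case: ifPn => [nr|].
  by rewrite mulr_ge0_le0 ?subr_le0// !mulr_ge0 ?pi_ge0// ltW.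
rewrite -ltNge => rn.
have -> : 2 * pi * r * (n%:R - r) = 2 * pi * r ^+ 2 * (n%:R / r - 1).
  by field; rewrite gt_eqF.
rewrite ler_wpM2l ?(ltW (cf r0))//.
have y1 : 1 <= n%:R / r by rewrite ler_pdivlMr// mul1r ltW.
rewrite -[leLHS]ger0_norm ?subr_ge0// -sqrtr_sqr ler_wsqrtr//.
by nra.
Qed.

Lemma damp_le r n : 0 < r -> damp r n <= 2 * pi * r * n%:R.
Proof.
move=> r0; rewrite /damp; case: ifPn => [nr|].
  by rewrite !mulr_ge0 ?pi_ge0// ltW.
rewrite -ltNge => rn.
have -> : 2 * pi * r * n%:R = 2 * pi * r ^+ 2 * (n%:R / r).
  by field; rewrite gt_eqF.
rewrite ler_wpM2l ?(ltW (cf r0))//.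
rewrite -[leRHS]ger0_norm ?divr_ge0 ?(ltW r0)// -sqrtr_sqr ler_wsqrtr//.
by rewrite gerDl lerN10.
Qed.

Lemma damp_le_succ r n : 0 < r -> damp r n <= damp r n.+1.
Proof.
move=> r0; have [nr|rn] := leP n%:R r; first by rewrite {1}/damp nr damp_ge0.
rewrite /damp !ifN -?ltNge//; last by rewrite (lt_trans rn)// ltr_nat.
rewrite ler_wpM2l ?(ltW (cf r0))// ler_wsqrtr// lerD2r lerXn2r ?nnegrE ?divr_ge0 ?(ltW r0)//.
by rewrite ler_wpM2r ?invr_ge0 ?(ltW r0)// ler_nat.
Qed.

Lemma damp_gap r n0 n : 0 < r -> r < n0%:R -> (n0 <= n)%N ->
  2 * pi * r * (n - n0)%:R <= damp r n.
Proof.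
move=> r0 rn0 n0n; apply: le_trans (damp_ge n r0).
rewrite ler_wpM2l ?mulr_ge0 ?pi_ge0 ?(ltW r0)// natrB//.
by rewrite lerD2l lerN2 ltW.
Qed.

Lemma freq_high r n : r < n%:R -> freq r n = - (2 * pi * r ^+ 2).
Proof. by move=> rn; rewrite /freq ifN// -ltNge. Qed.

Lemma damp_low r n : n%:R <= r -> damp r n = 0.
Proof. by move=> rn; rewrite /damp ifT. Qed.

Let ratio_le1 r n : 0 < r -> n%:R <= r -> 0 <= 1 - (n%:R / r) ^+ 2.
Proof.
move=> r0 nr; rewrite subr_ge0 exprn_ile1 ?divr_ge0 ?(ltW r0)//.
by rewrite ler_pdivrMr// mul1r.
Qed.

Lemma freq_lowE r n : 0 < r -> n%:R <= r ->
  freq r n = - (2 * pi * n%:R ^+ 2) / (1 + Num.sqrt (1 - (n%:R / r) ^+ 2)).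
Proof.
move=> r0 nr; rewrite /freq ifT//; set s := Num.sqrt _.
have s0 : 0 <= s by exact: sqrtr_ge0.
have s2 : s ^+ 2 = 1 - (n%:R / r) ^+ 2 by rewrite sqr_sqrtr// ratio_le1.
have n2 : n%:R ^+ 2 = r ^+ 2 * (1 - s ^+ 2).
  by rewrite s2 subKr expr_div_n mulrC divfK// sqrf_eq0 gt_eqF.
rewrite n2; field.
by rewrite gt_eqF// ltr_pwDl.
Qed.

Lemma norm_freq_low_ge r n : 0 < r -> n%:R <= r -> pi * n%:R ^+ 2 <= `|freq r n|.
Proof.
move=> r0 nr; rewrite freq_lowE//; set s := Num.sqrt _.
have s0 : 0 <= s by exact: sqrtr_ge0.
have s1 : s <= 1 by rewrite -sqrtr1 ler_wsqrtr// gerBl sqr_ge0.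
rewrite mulNr normrN ger0_norm; last first.
  by rewrite divr_ge0 ?addr_ge0// !mulr_ge0 ?pi_ge0 ?sqr_ge0.
rewrite ler_pdivlMr ?ltr_pwDl//.
have : 0 <= pi * n%:R ^+ 2 :> R by rewrite mulr_ge0 ?pi_ge0 ?sqr_ge0.
by nra.
Qed.

Lemma freq_cvg (u : nat -> R) n : u j @[j --> \oo] --> +oo ->
  freq (u j) n @[j --> \oo] --> - (pi * n%:R ^+ 2).
Proof.
move=> uy.
have uV : (u j)^-1 @[j --> \oo] --> (0:R) by apply/gtr0_cvgV0 => //; exact: ((cvgryPgt _).1 uy).
(* Rationalising the difference of square roots shows the limit. *)
have E : {near \oo, (fun j => - (2 * pi * n%:R ^+ 2) *
   (1 + Num.sqrt (1 - (n%:R * (u j)^-1) ^+ 2))^-1) =1 (fun j => freq (u j) n)}.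
  near=> j; rewrite freq_lowE//.
    by near: j; exact: ((cvgryPgt _).1 uy).
  by near: j; exact: ((cvgryPge _).1 uy).
apply: (cvg_trans (near_eq_cvg E)).
have -> : - (pi * n%:R ^+ 2) =
    - (2 * pi * n%:R ^+ 2) * (1 + Num.sqrt (1 - (n%:R * 0) ^+ 2))^-1 :> R.
  by rewrite mulr0 expr0n/= subr0 sqrtr1; field.
apply: cvgMr; apply: cvgV.
  by rewrite gt_eqF// ltr_pwDl// sqrtr_ge0.
apply: cvgD; first exact: cvg_cst.
apply: (@continuous_cvg _ _ _ _ _ (fun j => 1 - (n%:R / u j) ^+ 2) Num.sqrt).
  exact: sqrt_continuous.
apply: cvgB; first exact: cvg_cst.
by rewrite expr2; apply: cvgM; apply: cvgMr.
Unshelve. all: by end_near. Qed.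

(** The mode [n] as a function of the second variable, with phase [th]. *)
Definition mode r n th x : R := osc (damp r n) (freq r n) th x.

(** The real part ([th = 0]) and the imaginary part ([th = - pi / 2]) of
[w r xi x], for [x > 0]; see [w_wave]. *)
Definition wave r xi th x : R := limn (series (fun n => weight xi n * mode r n th x)).

Lemma norm_mode_le r n th x : `|mode r n th x| <= expR (- (damp r n * x)).
Proof.
rewrite /mode /osc normrM ger0_norm ?expR_ge0// ler_piMr ?expR_ge0//.
exact: cos_max.
Qed.

(* The constant absorbs the finitely many undamped modes. *)
Lemma expR_damp_le r n x : 0 < r -> 0 < x ->
  expR (- (damp r n * x)) <= expR (2 * pi * r ^+ 2 * x) * expR (- (2 * pi * r * x)) ^+ n.
Proof.
move=> r0 x0; rewrite -expRM_natl -expRD ler_expR.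
have := damp_ge n r0; rewrite -(ler_pM2r x0).
by nra.
Qed.

Lemma summable_damp r x : 0 < r -> 0 < x ->
  cvgn (series (fun n => 2 * expR (- (damp r n * x)))).
Proof.
move=> r0 x0.
apply: (@summable_dominated _ _
    (geometric (2 * expR (2 * pi * r ^+ 2 * x)) (expR (- (2 * pi * r * x))))).
  apply: is_cvg_geometric_series; rewrite ger0_norm ?expR_ge0//.
  by rewrite expR_lt1 oppr_lt0 !mulr_gt0 ?pi_gt0.
move=> n; rewrite /geometric/= ger0_norm ?mulr_ge0 ?expR_ge0// -[leRHS]mulrA ler_wpM2l//.
exact: expR_damp_le.
Qed.

Lemma norm_weight_mode_le r xi n th x :
  `|weight xi n * mode r n th x| <= 2 * expR (- (damp r n * x)).
Proof. by rewrite normrM ler_pM ?norm_weight_le ?norm_mode_le. Qed.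

Lemma summable_wave r xi th x : 0 < r -> 0 < x ->
  cvgn (series (fun n => weight xi n * mode r n th x)).
Proof.
move=> r0 x0; apply: summable_dominated (summable_damp r0 x0) _ => n.
exact: norm_weight_mode_le.
Qed.

(** The index of the first evanescent mode. *)
Definition cutoff r : nat := (Num.truncn r).+1.

Lemma cutoff_gt r : 0 < r -> r < (cutoff r)%:R.
Proof. by move=> r0; exact: truncnS_gt. Qed.

Lemma cutoff_le r : 0 < r -> (cutoff r)%:R <= r + 1.
Proof. by move=> r0; rewrite -natr1 lerD2r truncn_le// ltW. Qed.

(** The wave without its propagating modes and its first evanescent mode. The
latter is set apart because its damping may be arbitrarily small: the gap
between [r] and [cutoff r] has no lower bound. *)
Definition rest r xi th x : R :=
  wave r xi th x - series (fun n => weight xi n * mode r n th x) (cutoff r).+1.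

(** A bound on the partial sums of the remaining modes passes to the limit. *)
Lemma norm_rest_le r xi th x (B : R) : 0 < r -> 0 < x ->
  (forall k, `|\sum_((cutoff r).+1 <= n < (cutoff r).+1 + k) weight xi n * mode r n th x| <= B) ->
  `|rest r xi th x| <= B.
Proof.
move=> r0 x0 kB; have cw := @summable_wave r xi th x r0 x0.
set s := series _ in cw.
have L : `|s m - s (cutoff r).+1| @[m --> \oo] --> `|rest r xi th x|.
  by apply: cvg_norm; apply: cvgB => //; exact: cvg_cst.
rewrite -(cvg_lim _ L)//; apply: limr_le; first by apply/cvg_ex; eexists; exact: L.
near=> m; have Nm : ((cutoff r).+1 <= m)%N by near: m; exact: nbhs_infty_ge.
rewrite sub_series_geq//.
by have := kB (m - (cutoff r).+1)%N; rewrite subnKC.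
Unshelve. all: by end_near. Qed.

(** The dampings grow at least linearly beyond the cutoff, hence a geometric
series of ratio [q = exp (- 2 pi r x)], with sum at most [1 / (2 pi r x)]. *)
Lemma rest_inv_bound r xi th x : 0 < r -> 0 < x -> `|rest r xi th x| <= (pi * r * x)^-1.
Proof.
move=> r0 x0; apply: norm_rest_le => // k.
set s := 2 * pi * r * x; set q := expR (- s).
have s0 : 0 < s by rewrite !mulr_gt0 ?pi_gt0.
have qs : q * (1 + s) <= 1.
  rewrite /q expRN mulrC ler_pdivrMr ?expR_gt0// mul1r; exact: expR_ge1Dx.
have q0 : 0 < q by exact: expR_gt0.
(* Induction on k for a bound that is exact up to q (1 + s) <= 1. *)
suff : `|\sum_((cutoff r).+1 <= n < (cutoff r).+1 + k) weight xi n * mode r n th x|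
    <= 2 / s * (1 - q ^+ k).
  move=> h; rewrite (le_trans h)//.
  have -> : (pi * r * x)^-1 = 2 / s.
    rewrite /s; have := pi_gt0 R; move: (pi : R) => p p0; field.
    by rewrite !gt_eqF.
  by rewrite ler_piMr ?divr_ge0 ?(ltW s0)// gerBl exprn_ge0// ltW.
elim: k => [|k IH].
  by rewrite addn0 big_geq// normr0 expr0 subrr mulr0.
rewrite addnS big_nat_recr ?leq_addr//=.
apply: (le_trans (ler_normD _ _)); apply: (le_trans (lerD IH (norm_weight_mode_le _ _ _ _ _))).
have h : expR (- (damp r ((cutoff r).+1 + k) * x)) <= q ^+ k.+1.
  rewrite /q -expRM_natl ler_expR.
  have := @damp_gap r (cutoff r) ((cutoff r).+1 + k) r0 (cutoff_gt r0).
  rewrite addSnnS leq_addr addKn => /(_ isT); rewrite -(ler_pM2r x0) /s.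
  by lra.
rewrite exprS in h *.
have qk : 0 < q ^+ k by rewrite exprn_gt0.
apply: (le_trans (lerD (lexx _) (ler_wpM2l _ h))) => //.
rewrite -subr_ge0 (_ : _ - _ = 2 / s * q ^+ k * (1 - q * (1 + s))); last first.
  by field; rewrite gt_eqF.
by rewrite mulr_ge0 ?subr_ge0// mulr_ge0 ?divr_ge0 ?ltW.
Qed.

(** Summation by parts: the amplitudes decrease with [n], and the cosine sums are
bounded because [xi] is not an integer. *)
Lemma rest_bounded xi : xi \isn't a Num.int -> exists2 C, 0 <= C &
  forall r th x, 0 < r -> 0 < x -> `|rest r xi th x| <= C.
Proof.
move=> /cos_sum_bounded[C C0 CS]; exists C => // r th x r0 x0.
apply: norm_rest_le => // k.
have E : \sum_((cutoff r).+1 <= n < (cutoff r).+1 + k) weight xi n * mode r n th x =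
  (\sum_((cutoff r).+1 <= n < (cutoff r).+1 + k) (2 * cos (2 * pi * n%:R * xi)) *
    expR (- (damp r n * x))) * cos (- (2 * pi * r ^+ 2) * x + th).
  rewrite big_distrl/= !big_nat; apply: eq_bigr => n /andP[cn _].
  rewrite /weight gtn_eqF ?(leq_trans _ cn)// /mode /osc mulrA freq_high//.
  by rewrite (lt_le_trans (cutoff_gt r0))// ler_nat ltnW.
rewrite E normrM -[leRHS]mulr1 ler_pM ?cos_max//.
apply: le_trans (abel_bound (c := fun n => expR (- (damp r n * x))) (leq_addr _ _) C0 _ _ _) _.
- by move=> n; exact: CS.
- by move=> n; exact: expR_ge0.
- by move=> n _; rewrite ler_expR lerN2 ler_wpM2r ?damp_le_succ// ltW.
- by rewrite ler_piMr// expR_le1 oppr_le0 mulr_ge0 ?damp_ge0// ltW.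
Qed.

End Modes.

(** * The limit of the wave *)

Section WaveLimit.
Set Implicit Arguments.
Unset Strict Implicit.
Context {R : realType}.
Implicit Types (r x xi th : R) (n : nat) (g : R -> R).
Notation mu := (@lebesgue_measure R).

(** A function of this class that vanishes at 0 is O(x / (1 + x ^ 2)). *)
Lemma C1_decay_vanishing g g' : C1_decay g g' -> g 0 = 0 ->
  exists C, forall x, 0 < x -> `|g x| <= C * x * (1 + x ^+ 2)^-1.
Proof.
move=> gg' g0; have cg := C1_decay_continuous gg'.
have [C [dg _ gC gC']] := gg'.
have C0 := decay_ge0 gC.
have p1 x : 0 < 1 + x ^+ 2 by rewrite ltr_pwDl ?sqr_ge0.
exists (2 * C) => x x0; have [x1|/ltW x1] := leP x 1; last first.
  rewrite (le_trans (gC x))// ler_wpM2r ?invr_ge0 ?(ltW (p1 _))//.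
  by nra.
have [c _] := MVT x0 (fun y _ => dg y) (continuous_subspaceT cg).
rewrite g0 !subr0 => ->; rewrite normrM (gtr0_norm x0).
have g'C : `|g' c| <= C.
  rewrite (le_trans (gC' c))// ler_piMr// invf_le1//.
  by rewrite lerDl sqr_ge0.
rewrite ler_pdivlMr//.
apply: (@le_trans _ _ (C * x * 2)); last by rewrite mulrC mulrA.
rewrite ler_pM ?mulr_ge0 ?(ltW (p1 _)) ?(ltW x0)//.
  by rewrite ler_wpM2r// ltW.
by rewrite -[2]/(1 + 1) lerD2l expr_le1// ltW.
Qed.

(** A majorant independent of [r]: [rest_bounded] gives it when [xi] is not an
integer, and [rest_inv_bound] when [g] compensates the singularity [1 / x]. *)
Lemma rest_dominated g g' xi r0 : C1_decay g g' -> 0 < r0 ->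
  (xi \isn't a Num.int) \/ g 0 = 0 ->
  exists C, forall r th x, r0 <= r -> 0 < x ->
    `|g x * rest r xi th x| <= C * (1 + x ^+ 2)^-1.
Proof.
move=> gg' r00; have p1 x : 0 < 1 + x ^+ 2 by rewrite ltr_pwDl ?sqr_ge0.
case=> [/rest_bounded[B B0 restB]|g0].
  have [C [_ _ gC _]] := gg'; exists (C * B) => r th x r0r x0.
  rewrite normrM mulrAC ler_pM//.
  by apply: restB => //; exact: lt_le_trans r0r.
have [C gC] := C1_decay_vanishing gg' g0.
exists (C * (pi * r0)^-1) => r th x r0r x0.
have rp : 0 < r by exact: lt_le_trans r0r.
rewrite normrM (le_trans (ler_pM _ _ (gC x x0) (rest_inv_bound xi th rp x0)))//.
have C0 : 0 <= C.
  have := le_trans (normr_ge0 _) (gC x x0).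
  by rewrite pmulr_lge0 ?invr_gt0// pmulr_lge0.
rewrite (_ : C * x / (1 + x ^+ 2) / (pi * r * x) = C * (pi * r)^-1 * (1 + x ^+ 2)^-1); last first.
  by rewrite [(pi * r * x)^-1]invfM; move: (pi * r)^-1 (_ + _)^-1 => p q; field; rewrite gt_eqF.
rewrite ler_wpM2r ?invr_ge0 ?(ltW (p1 _))// ler_wpM2l//.
by rewrite lef_pV2 ?posrE ?mulr_gt0 ?pi_gt0// ler_wpM2l// pi_ge0.
Qed.

(** The pairing of [g] with one mode over the positive half line. *)
Definition mode_integral g r n th := \int[mu]_(x in `]0, +oo[) (g x * mode r n th x).

Lemma integrable_mode g r n th : mu.-integrable `]0, +oo[ (EFin \o g) ->
  mu.-integrable `]0, +oo[ (EFin \o (fun x => g x * mode r n th x)).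
Proof. by apply: integrable_mul_osc; exact: damp_ge0. Qed.

Lemma partial_wave_integral g r xi th N : mu.-integrable `]0, +oo[ (EFin \o g) ->
  mu.-integrable `]0, +oo[
    (EFin \o (fun x => g x * series (fun n => weight xi n * mode r n th x) N)) /\
  \int[mu]_(x in `]0, +oo[) (g x * series (fun n => weight xi n * mode r n th x) N) =
  series (fun n => weight xi n * mode_integral g r n th) N.
Proof.
move=> gi; elim: N => [|N [IHi IH]].
  rewrite (_ : (fun x => _) = (fun x => 0 * g x)); last first.
    by apply/funext => x; rewrite /series/= big_geq// mulr0 mul0r.
  split; first exact: integrable_scale.
  by rewrite RintegralZl// mul0r /series/= big_geq.
have E : (fun x => g x * series (fun n => weight xi n * mode r n th x) N.+1) =
  (fun x => g x * series (fun n => weight xi n * mode r n th x) N +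
            weight xi N * (g x * mode r N th x)).
  by apply/funext => x; rewrite seriesSr mulrDr; congr (_ + _); ring.
have mi := integrable_mode r N th gi.
rewrite E; split.
  by apply: integrable_add => //; exact: integrable_scale.
rewrite RintegralD//; last exact: integrable_scale.
by rewrite IH RintegralZl// seriesSr.
Qed.

Lemma measurable_wave r xi th : 0 < r ->
  measurable_fun (`]0, +oo[ : set R) (wave r xi th).
Proof.
move=> r0; apply: (@measurable_fun_cvg _ _ _ _
  (fun N x => series (fun n => weight xi n * mode r n th x) N)).
- move=> N; apply: measurable_funTS.
  apply: measurable_sum => n; apply: measurable_funM => //.
  by apply: continuous_measurable_fun; exact: continuous_osc.
- by move=> x /=; rewrite in_itv/= andbT => x0; exact: summable_wave.
Qed.

Lemma measurable_rest r xi th : 0 < r ->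
  measurable_fun (`]0, +oo[ : set R) (rest r xi th).
Proof.
move=> r0; apply: measurable_funB; first exact: measurable_wave.
apply: measurable_funTS; apply: measurable_sum => n; apply: measurable_funM => //.
by apply: continuous_measurable_fun; exact: continuous_osc.
Qed.

Lemma integrable_mul_rest g g' xi r th : C1_decay g g' -> 0 < r ->
  (xi \isn't a Num.int) \/ g 0 = 0 ->
  mu.-integrable `]0, +oo[ (EFin \o (fun x => g x * rest r xi th x)).
Proof.
move=> gg' r0 xig; have [C gC] := rest_dominated gg' r0 xig.
apply: (@integrable_decay _ _ C).
  apply: measurable_funM; last exact: measurable_rest.
  exact: measurable_integrable (C1_decay_integrable gg').
by move=> x x0; exact: gC.
Qed.

Lemma wave_integral g g' xi r th : C1_decay g g' -> 0 < r ->
  (xi \isn't a Num.int) \/ g 0 = 0 ->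
  mu.-integrable `]0, +oo[ (EFin \o (fun x => g x * wave r xi th x)) /\
  \int[mu]_(x in `]0, +oo[) (g x * wave r xi th x) =
    series (fun n => weight xi n * mode_integral g r n th) (cutoff r).+1 +
    \int[mu]_(x in `]0, +oo[) (g x * rest r xi th x).
Proof.
move=> gg' r0 xig; have ri := integrable_mul_rest th gg' r0 xig.
have [pint pE] := partial_wave_integral r xi th (cutoff r).+1 (C1_decay_integrable gg').
have E : (fun x => g x * wave r xi th x) =
  (fun x => g x * series (fun n => weight xi n * mode r n th x) (cutoff r).+1 +
    g x * rest r xi th x).
  by apply/funext => x; rewrite -mulrDr /rest addrC subrK.
by rewrite E; split; [exact: integrable_add|rewrite RintegralD// pE].
Qed.

Lemma rest_integral_cvg0 g g' xi th (u : nat -> R) : C1_decay g g' ->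
  (xi \isn't a Num.int) \/ g 0 = 0 -> (forall j, 1 <= u j) ->
  u j @[j --> \oo] --> +oo ->
  \int[mu]_(x in `]0, +oo[) (g x * rest (u j) xi th x) @[j --> \oo] --> (0:R).
Proof.
move=> gg' xig u1 uy; have [C gC] := rest_dominated gg' ltr01 xig.
have u0 j : 0 < u j by exact: lt_le_trans (u1 j).
rewrite -[X in _ --> X](_ : \int[mu]_(x in `]0, +oo[) 0 = 0); last first.
  by rewrite /Rintegral integral0.
apply: (@Rintegral_dominated_cvg _ _ _ _ (fun x => C * (1 + x ^+ 2)^-1)) => //.
- move=> j; apply: measurable_funM; last exact: measurable_rest.
  exact: measurable_integrable (C1_decay_integrable gg').
- exact: integrable_oneDsqrV.
- by move=> j x /=; rewrite in_itv/= andbT => x0; exact: gC.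
- move=> x /=; rewrite in_itv/= andbT => x0.
  rewrite -[X in _ --> X](mulr0 (g x)); apply: cvgMr; apply/norm_cvg0P.
  have uV : (u j)^-1 @[j --> \oo] --> (0:R).
    by apply/gtr0_cvgV0 => //; exact: nearW.
  have h : (pi * x)^-1 * (u j)^-1 @[j --> \oo] --> (0:R).
    by rewrite -[X in _ --> X](mulr0 (pi * x)^-1); exact: cvgMr.
  apply: (squeeze_cvgr _ (cvg_cst 0) h); apply: nearW => j.
  by rewrite normr_ge0/= -invfM mulrAC rest_inv_bound.
Qed.

(** The pairing of [g] with the [n]-th term of the limit distribution, whose
exponent is [- i pi n ^ 2]. *)
Definition limit_integral g n th :=
  \int[mu]_(x in `]0, +oo[) (g x * osc 0 (- (pi * n%:R ^+ 2)) th x).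

Lemma mode_integral_cvg g n th (u : nat -> R) : mu.-integrable `]0, +oo[ (EFin \o g) ->
  u j @[j --> \oo] --> +oo ->
  mode_integral g (u j) n th @[j --> \oo] --> limit_integral g n th.
Proof.
move=> gi uy; apply: (@Rintegral_dominated_cvg _ _ _ _ (fun x => `|g x|)) => //.
- by move=> j; apply: measurable_integrable; exact: integrable_mode.
- exact: integrable_norm.
- move=> j x /=; rewrite in_itv/= andbT => /ltW x0; rewrite normrM ler_piMr//.
  by apply: norm_osc_le => //; exact: damp_ge0.
- move=> x _; apply: cvgMr.
  have E : {near \oo, (fun j => expR (- (0 * x)) * cos (freq (u j) n * x + th)) =1
      (fun j => mode (u j) n th x)}.
    near=> j; rewrite /mode /osc damp_low//.
    by near: j; exact: ((cvgryPge _).1 uy).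
  apply: (cvg_trans (near_eq_cvg E)); apply: cvgMr.
  apply: (@continuous_cvg _ _ _ _ _ (fun j => freq (u j) n * x + th) cos).
    exact: continuous_cos.
  apply: cvgD; last exact: cvg_cst.
  by apply: cvgMl; exact: freq_cvg.
Unshelve. all: by end_near. Qed.

(** The pairings with the propagating modes, with the first evanescent mode and
with the limit modes are summable in [n], uniformly in [r >= 1]. *)
Lemma mode_integral_dominated g g' : C1_decay g g' -> exists C,
  (forall r n th, 1 <= r -> (n <= cutoff r)%N ->
    `|mode_integral g r n th| <= C * (1 + n%:R ^+ 2)^-1) /\
  (forall n th, `|limit_integral g n th| <= C * (1 + n%:R ^+ 2)^-1).
Proof.
move=> gg'; have gi := C1_decay_integrable gg'.
have [K K0 gK] := oscillatory_bound gg'.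
pose G := \int[mu]_(x in `]0, +oo[) `|g x|.
have G0 : 0 <= G by apply: Rintegral_ge0.
have p0 : 0 < pi :> R := pi_gt0 R.
pose C := G + 5 * K / pi.
(* The factor 5 is needed for the first evanescent mode only: there n <= 2 r,
   hence 1 + n ^ 2 <= 5 r ^ 2. *)
have key n a b th : 0 <= a -> (0 < n)%N ->
    pi * (1 + n%:R ^+ 2) <= 5 * `|b| ->
    `|\int[mu]_(x in `]0, +oo[) (g x * osc a b th x)| <= C * (1 + n%:R ^+ 2)^-1.
  move=> a0 n0 nb; have n1 : 0 < 1 + n%:R ^+ 2 :> R by rewrite ltr_pwDl ?sqr_ge0.
  have b0 : 0 < `|b|.
    by rewrite -(pmulr_rgt0 _ (ltr0Sn _ 4)) (lt_le_trans _ nb)// mulr_gt0.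
  apply: le_trans (gK a b th a0 _) _; first by rewrite -normr_gt0.
  apply: (@le_trans _ _ (5 * K / pi * (1 + n%:R ^+ 2)^-1)); last first.
    by rewrite ler_wpM2r ?invr_ge0 ?(ltW n1)// lerDr.
  have nb' : `|b|^-1 <= 5 / (pi * (1 + n%:R ^+ 2)).
    by rewrite ler_pdivlMr ?mulr_gt0// mulrC ler_pdivrMr.
  rewrite (_ : 5 * K / pi / _ = K * (5 / (pi * (1 + n%:R ^+ 2)))) ?ler_wpM2l//.
  by rewrite [(pi * _)^-1]invfM; ring.
have key0 th a b : 0 <= a ->
    `|\int[mu]_(x in `]0, +oo[) (g x * osc a b th x)| <= C * (1 + 0%:R ^+ 2)^-1.
  move=> a0; rewrite expr0n/= addr0 invr1 mulr1.
  have oi := integrable_mul_osc b th a0 gi.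
  apply: le_trans (le_normr_Rintegral _ oi) _ => //.
  apply: (@le_trans _ _ G); last by rewrite lerDl divr_ge0 ?mulr_ge0// ltW.
  apply: le_Rintegral => //; [exact: integrable_norm|exact: integrable_norm|].
  move=> x /=; rewrite in_itv/= andbT => /ltW x0; rewrite normrM ler_piMr//.
  exact: norm_osc_le.
have sq n : (0 < n)%N -> 1 <= n%:R ^+ 2 :> R.
  by move=> n0; rewrite exprn_ege1// ler1n.
exists C; split=> [r [|n] th r1 ncr|[|n] th].
- by apply: key0 => //; exact: damp_ge0.
- apply: key => //; first exact: damp_ge0.
  have r0 : 0 < r by exact: lt_le_trans r1.
  have [nr|rn] := leP n.+1%:R r.
    have := norm_freq_low_ge r0 nr; have := sq n.+1 isT.
    by nra.
  rewrite freq_high// normrN ger0_norm; last by rewrite mulr_ge0 ?sqr_ge0// mulr_ge0 ?pi_ge0.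
  have nr : n.+1%:R <= r + 1.
    by apply: le_trans (cutoff_le r0); rewrite ler_nat.
  have : n.+1%:R ^+ 2 <= (2 * r) ^+ 2.
    by rewrite lerXn2r ?nnegrE ?mulr_ge0 ?(ltW r0)//; lra.
  rewrite (_ : 5 * _ = pi * (10 * r ^+ 2)); last by move: (pi : R) => p; ring.
  rewrite ler_pM2l//.
  by nra.
- exact: key0.
- apply: key => //; rewrite normrN ger0_norm ?mulr_ge0 ?sqr_ge0 ?pi_ge0//.
  by have := sq n.+1 isT; nra.
Qed.

Lemma summable_limit_integral g g' xi th : C1_decay g g' ->
  cvgn (series (fun n => weight xi n * limit_integral g n th)).
Proof.
move=> /mode_integral_dominated[C [_ gC]].
by apply: summable_weight (@summable_inv_sqr _ C) _ => n; exact: gC.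
Qed.

(** Along any sequence tending to infinity, the rest contributes nothing in the
limit and dominated convergence for series applies to the other modes. *)
Lemma wave_integral_cvg g g' xi th : C1_decay g g' ->
  (xi \isn't a Num.int) \/ g 0 = 0 ->
  \int[mu]_(x in `]0, +oo[) (g x * wave r xi th x) @[r --> +oo] -->
    limn (series (fun n => weight xi n * limit_integral g n th)).
Proof.
move=> gg' xig; apply/cvg_pinftyP => u' u'y.
(* The dominations hold for r >= 1. *)
pose u j := Num.max 1 (u' j).
have u1 j : 1 <= u j by rewrite le_max lexx.
have u0 j : 0 < u j by exact: lt_le_trans (u1 j).
have uu' : \forall j \near \oo, u j = u' j.
  near=> j; rewrite /u max_r//; near: j; exact: ((cvgryPge _).1 u'y).
have uy : u j @[j --> \oo] --> +oo.
  apply: cvg_trans u'y; apply: near_eq_cvg.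
  by near=> j; apply/esym; near: j.
have E : {near \oo, (fun j => \int[mu]_(x in `]0, +oo[) (g x * wave (u j) xi th x)) =1
    (fun j => \int[mu]_(x in `]0, +oo[) (g x * wave (u' j) xi th x))}.
  by near=> j; have -> : u j = u' j by near: j.
suff : \int[mu]_(x in `]0, +oo[) (g x * wave (u j) xi th x) @[j --> \oo] -->
    limn (series (fun n => weight xi n * limit_integral g n th)).
  by apply: cvg_trans; exact: near_eq_cvg E.
rewrite (_ : (fun j => _) = (fun j =>
  series (fun n => weight xi n * mode_integral g (u j) n th) (cutoff (u j)).+1 +
  \int[mu]_(x in `]0, +oo[) (g x * rest (u j) xi th x))); last first.
  by apply/funext => j; have [_ ->] := wave_integral th gg' (u0 j) xig.
rewrite -[X in _ --> X]addr0; apply: cvgD; last exact: rest_integral_cvg0 gg' _ _ _.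
(* The finite sums as series with finitely many nonzero terms. *)
pose U j n := if (n < (cutoff (u j)).+1)%N
  then weight xi n * mode_integral g (u j) n th else 0.
have UE j : series (fun n => weight xi n * mode_integral g (u j) n th) (cutoff (u j)).+1
    = limn (series (U j)).
  apply/esym/cvg_lim => //; apply: cvg_near_cst; near=> m.
  rewrite /series/= (@big_cat_nat _ _ _ (cutoff (u j)).+1)//=; last first.
    by near: m; exact: nbhs_infty_ge.
  rewrite [X in _ + X]big_nat_cond [X in _ + X]big1 ?addr0.
    by rewrite !big_mkord; apply: eq_bigr => i _; rewrite /U ltn_ord.
  by move=> i; rewrite andbT /U => /andP[h _]; rewrite ltnNge h.
rewrite (_ : (fun j => _) = (fun j => limn (series (U j)))); last exact/funext.
have [C [gC gC']] := mode_integral_dominated gg'.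
have C0 : 0 <= C.
  by have := le_trans (normr_ge0 _) (gC' 0%N 0); rewrite expr0n/= addr0 invr1 mulr1.
apply: (@series_dominated_cvg _ _ _ (fun n => 2 * C * (1 + n%:R ^+ 2)^-1)).
- exact: summable_inv_sqr.
- move=> j n; rewrite /U; case: ifPn => [h|_].
    by rewrite normrM -mulrA ler_pM ?norm_weight_le ?gC.
  by rewrite normr0 !mulr_ge0// invr_ge0 addr_ge0 ?sqr_ge0.
- move=> n.
  have E2 : {near \oo, (fun j => weight xi n * mode_integral g (u j) n th) =1
      (fun j => U j n)}.
    near=> j; rewrite /U ifT//.
    rewrite ltnS -(ler_nat R) (le_trans _ (ltW (cutoff_gt (u0 j))))//.
    by near: j; exact: ((cvgryPge _).1 uy).
  apply: (cvg_trans (near_eq_cvg E2)); apply: cvgMr.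
  exact: mode_integral_cvg (C1_decay_integrable gg') uy.
Unshelve. all: by end_near. Qed.

End WaveLimit.

(** * Non-integrability at the origin *)

Section NonIntegrability.
Set Implicit Arguments.
Unset Strict Implicit.
Context {R : realType}.
Implicit Types (r x xi th : R) (n : nat) (f g h : R -> R).
Notation mu := (@lebesgue_measure R).

(** The integrals of an integrable function over the intervals [(e / 2, e]] tend
to 0 with [e], whereas those of [c / x] are at least [c / 2]. *)
Lemma not_integrable_inv f (c d : R) : 0 < c -> 0 < d ->
  (forall x, 0 < x -> x < d -> c / x <= f x) ->
  ~ mu.-integrable `]0, +oo[ (EFin \o f).
Proof.
move=> c0 d0 cf fi.
pose e k : R := d * k.+2%:R^-1.
have e0 k : 0 < e k by rewrite mulr_gt0 ?invr_gt0.
have ed k : e k < d.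
  by rewrite /e gtr_pMr// invf_lt1// ltr1n.
have ecvg : e k @[k --> \oo] --> (0:R).
  rewrite -[X in _ --> X](mulr0 d); apply: cvgMr.
  by have := @cvg_harmonic R; rewrite -(cvg_shiftS (@harmonic R)).
pose A k : set R := (`]e k / 2, e k])%classic.
have mA k : measurable (A k) by exact: measurable_itv.
have L : \int[mu]_(x in `]0, +oo[) (f \_ (A k)) x @[k --> \oo] --> (0:R).
  rewrite -[X in _ --> X](_ : \int[mu]_(x in `]0, +oo[) 0 = 0); last first.
    by rewrite /Rintegral integral0.
  apply: (@Rintegral_dominated_cvg _ _ _ _ (fun x => `|f x|)) => //.
  - move=> k; rewrite patch_indic; apply: measurable_funM.
      exact: measurable_integrable fi.
    apply: measurable_indic; exact: mA.
  - exact: integrable_norm.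
  - by move=> k x _; rewrite patchE; case: ifP => // _; rewrite normr0.
  - move=> x /=; rewrite in_itv/= andbT => x0.
    apply: cvg_near_cst; near=> k; rewrite patchE memNset//=.
    rewrite /A/= in_itv/= => /andP[_]; apply/negP; rewrite -ltNge.
    by near: k; exact: (cvgr_lt _ ecvg).
have ge k : c / 2 <= \int[mu]_(x in `]0, +oo[) (f \_ (A k)) x.
  have AD : `]0, +oo[ `&` A k = A k.
    apply/seteqP; split => [x []//|x]; rewrite /A/= !in_itv/= andbT => /[dup] Ax /andP[+ _].
    by move=> h; split => //; rewrite (lt_trans _ h)// divr_gt0.
  have -> : c / 2 = \int[mu]_(x in `]0, +oo[) ((cst (c / e k)) \_ (A k)) x.
    have muA : mu (A k) = (e k / 2)%:E.
      apply: etrans (lebesgue_measure_itv _) _; rewrite /= lte_fin.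
      rewrite gtr_pMr// invf_lt1// ltr1n -EFinB; congr EFin.
      by move: (e k) => z; field.
    rewrite -Rintegral_mkcondr AD Rintegral_cst; last exact: mA.
    transitivity (c / e k * (e k / 2)); last exact: (congr1 (fun t => _ * fine t) (esym muA)).
    by have := e0 k; move: (e k) => z z0; field; rewrite gt_eqF.
  apply: le_Rintegral => //.
  - have : mu.-integrable `]0, +oo[ (EFin \o (fun x => c / e k * \1_(A k) x)).
      apply: integrable_scale => //.
      by apply: integrableS (integrable_indic_itv (e k / 2) (e k) false false).
    by rewrite [X in _ (EFin \o X)](_ : _ = cst (c / e k) \_ (A k))// patch_indic.
  - apply: (@integrable_dominated _ _ _ (fun x => `|f x|)) => //.
    + rewrite patch_indic; apply: measurable_funM.
        exact: measurable_integrable fi.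
      apply: measurable_indic; exact: mA.
    + exact: integrable_norm.
    + by move=> x _; rewrite patchE; case: ifP => // _; rewrite normr0.
  - move=> x _; rewrite !patchE; case: ifPn => //; rewrite inE /A/= in_itv/= => /andP[h1 h2].
    have x0 : 0 < x by rewrite (lt_trans _ h1)// divr_gt0.
    rewrite (le_trans _ (cf x x0 (le_lt_trans h2 (ed k))))//.
    by rewrite ler_wpM2l ?(ltW c0)// lef_pV2 ?posrE.
have : c / 2 <= 0.
  by rewrite -(cvg_lim _ L)//; apply: limr_ge; [apply/cvg_ex; eexists; exact: L|exact: nearW].
by rewrite leNgt divr_gt0.
Unshelve. all: by end_near. Qed.

(** The sum of all evanescent modes is this real amplitude times an oscillation
of frequency [- 2 pi r ^ 2]; see [wave_high]. *)
Definition high_amplitude r xi x : R :=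
  limn (series (fun n => weight xi n * expR (- (damp r n * x)))) -
  series (fun n => weight xi n * expR (- (damp r n * x))) (cutoff r).

Lemma summable_weight_damp r xi x : 0 < r -> 0 < x ->
  cvgn (series (fun n => weight xi n * expR (- (damp r n * x)))).
Proof.
move=> r0 x0; apply: summable_dominated (summable_damp r0 x0) _ => n.
by rewrite normrM (ger0_norm (expR_ge0 _)) ler_pM// norm_weight_le.
Qed.

Lemma wave_high r xi th x : 0 < r -> 0 < x ->
  wave r xi th x = series (fun n => weight xi n * mode r n th x) (cutoff r) +
    high_amplitude r xi x * cos (- (2 * pi * r ^+ 2) * x + th).
Proof.
move=> r0 x0; set k := cos _.
have cw := @summable_wave _ r xi th x r0 x0.
have cd := @summable_weight_damp r xi x r0 x0.
rewrite /wave /high_amplitude; set s := series _ in cw *; set d := series _ in cd *.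
suff L : s m @[m --> \oo] --> s (cutoff r) + (limn d - d (cutoff r)) * k.
  exact: cvg_lim L.
have L : s (cutoff r) + (d m - d (cutoff r)) * k @[m --> \oo] -->
    s (cutoff r) + (limn d - d (cutoff r)) * k.
  apply: cvgD; first exact: cvg_cst.
  by apply: cvgMl; apply: cvgB => //; exact: cvg_cst.
apply: cvg_trans L; apply: near_eq_cvg; near=> m.
have Nm : (cutoff r <= m)%N by near: m; exact: nbhs_infty_ge.
apply/eqP; rewrite addrC eq_sym -subr_eq !sub_series_geq//.
rewrite big_distrl/= !big_nat; apply/eqP; apply: eq_bigr => n /andP[cn _].
rewrite /mode /osc freq_high; first by rewrite -/k mulrA.
by apply: lt_le_trans (cutoff_gt r0) _; rewrite ler_nat.
Unshelve. all: by end_near. Qed.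

(** For integer [xi] all weights are positive, and the amplitude dominates a
geometric series of ratio [q = exp (- 2 pi r x)], which blows up like [1 / x]. *)
Lemma high_amplitude_ge r xi : 0 < r -> xi \is a Num.int ->
  exists2 c, 0 < c & forall x, 0 < x -> x < 1 -> c / x <= high_amplitude r xi x.
Proof.
move=> r0 xiZ; pose N := cutoff r.
exists (expR (- (2 * pi * r * N%:R)) / (pi * r)).
  by rewrite divr_gt0 ?expR_gt0// mulr_gt0 ?pi_gt0.
move=> x x0 x1; set s := 2 * pi * r * x; set q := expR (- s).
have s0 : 0 < s by rewrite !mulr_gt0 ?pi_gt0.
have q0 : 0 < q by exact: expR_gt0.
have q1 : q < 1 by rewrite expR_lt1 oppr_lt0.
have qs : 1 - s <= q by exact: expR_ge1Dx.
have cd := @summable_weight_damp r xi x r0 x0.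
have low k : 2 * q ^+ N / s * (1 - q ^+ k) <=
    \sum_(N <= n < N + k) weight xi n * expR (- (damp r n * x)).
  elim: k => [|k IH]; first by rewrite addn0 big_geq// expr0 subrr mulr0.
  rewrite addnS big_nat_recr ?leq_addr//=.
  have h : 2 * q ^+ N * q ^+ k <= weight xi (N + k) * expR (- (damp r (N + k) * x)).
    rewrite /weight /N/= cos_int// mulr1 -mulrA ler_wpM2l// -exprD.
    rewrite /q -expRM_natl ler_expR mulrN lerN2 [leRHS]mulrC.
    rewrite /s [leRHS]mulrAC ler_wpM2r ?(ltW x0)//; exact: damp_le.
  apply: le_trans (lerD IH h).
  rewrite -subr_ge0 exprS (_ : _ - _ = 2 * q ^+ N * q ^+ k * (q - (1 - s)) / s); last first.
    by field; rewrite gt_eqF.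
  by rewrite divr_ge0 ?(ltW s0)// mulr_ge0 ?subr_ge0// !mulr_ge0// exprn_ge0// ltW.
have high k : \sum_(N <= n < N + k) weight xi n * expR (- (damp r n * x)) <=
    high_amplitude r xi x.
  rewrite /high_amplitude -sub_series_geq ?leq_addr// lerD2r.
  apply: nondecreasing_cvgn_le => //; apply: nondecreasing_series => n _ _.
  rewrite mulr_ge0 ?expR_ge0// /weight; case: ifP => // _.
  by rewrite cos_int ?mulr1.
have L : 2 * q ^+ N / s * (1 - q ^+ k) @[k --> \oo] --> 2 * q ^+ N / s * (1 - 0).
  apply: cvgMr; apply: cvgB; first exact: cvg_cst.
  by apply: cvg_expr; rewrite gtr0_norm.
have : 2 * q ^+ N / s * (1 - 0) <= high_amplitude r xi x.
  rewrite -(cvg_lim _ L)//; apply: limr_le; first by apply/cvg_ex; eexists; exact: L.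
  by apply: nearW => k; exact: le_trans (low k) (high k).
apply: le_trans; rewrite subr0 mulr1.
have -> : 2 * q ^+ N / s = q ^+ N / (pi * r) / x.
  rewrite /s; have := pi_gt0 R; move: (pi : R) (q ^+ N) => p Q p0; field.
  by rewrite !gt_eqF.
rewrite ler_wpM2r ?invr_ge0 ?(ltW x0)// ler_wpM2r ?invr_ge0 ?mulr_ge0 ?pi_ge0 ?(ltW r0)//.
rewrite /q -expRM_natl ler_expR mulrN lerN2 /s [leLHS]mulrC.
by rewrite [leLHS]mulrAC ler_piMr ?(ltW x1)// !mulr_ge0 ?pi_ge0 ?(ltW r0).
Qed.

(** For integer [xi] the wave is not integrable against a function [g + i h] that
does not vanish at the origin: the two displayed functions are the real and
imaginary parts of the product. *)
Lemma wave_not_integrable g g' h h' r xi : C1_decay g g' -> C1_decay h h' ->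
  0 < r -> xi \is a Num.int -> (g 0 != 0) || (h 0 != 0) ->
  mu.-integrable `]0, +oo[ (EFin \o
    (fun x => g x * wave r xi 0 x - h x * wave r xi (- (pi / 2)) x)) ->
  ~ mu.-integrable `]0, +oo[ (EFin \o
    (fun x => h x * wave r xi 0 x + g x * wave r xi (- (pi / 2)) x)).
Proof.
move=> gg' hh' r0 xiZ gh0 Ai Bi.
have gi := C1_decay_integrable gg'; have hi := C1_decay_integrable hh'.
pose S th x := series (fun n => weight xi n * mode r n th x) (cutoff r).
pose T := high_amplitude r xi; pose b x := - (2 * pi * r ^+ 2) * x.
have E0 x : 0 < x -> wave r xi 0 x = S 0 x + T x * cos (b x).
  by move=> x0; rewrite wave_high// addr0.
have E1 x : 0 < x -> wave r xi (- (pi / 2)) x = S (- (pi / 2)) x + T x * sin (b x).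
  by move=> x0; rewrite wave_high// cosBpihalf.
have gS th := (partial_wave_integral r xi th (cutoff r) gi).1.
have hS th := (partial_wave_integral r xi th (cutoff r) hi).1.
have A'i := integrable_sub (measurable_itv _) Ai
  (integrable_sub (measurable_itv _) (gS 0) (hS (- (pi / 2)))).
have B'i := integrable_sub (measurable_itv _) Bi
  (integrable_add (measurable_itv _) (hS 0) (gS (- (pi / 2)))).
have fi := integrable_add (measurable_itv _) (integrable_norm A'i) (integrable_norm B'i).
have [c c0 cT] := high_amplitude_ge r0 xiZ.
(* Rotating the product back by the angle b x recovers T g and T h. *)
suff key k : continuous k -> k 0 != 0 ->
    (forall x, 0 < x -> exists u v, [/\ `|u| <= 1, `|v| <= 1 &
      T x * k x = u * (T x * (g x * cos (b x) - h x * sin (b x))) +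
                  v * (T x * (h x * cos (b x) + g x * sin (b x)))]) -> False.
  case/orP: gh0 => [g0|h0].
    apply: (key g) => //; first exact: C1_decay_continuous gg'.
    move=> x x0; exists (cos (b x)), (sin (b x)); rewrite cos_max sin_max; split => //.
    rewrite -[LHS]mulr1 -(cos2Dsin2 (b x)); ring.
  apply: (key h) => //; first exact: C1_decay_continuous hh'.
  move=> x x0; exists (- sin (b x)), (cos (b x)); rewrite normrN cos_max sin_max; split => //.
  rewrite -[LHS]mulr1 -(cos2Dsin2 (b x)); ring.
move=> ck k0 kuv.
have k2 : 0 < `|k 0| / 2 by rewrite divr_gt0// normr_gt0.
have [d /= d0 dk] : exists2 d, 0 < d & forall x, `|x| < d -> `|k 0| / 2 <= `|k x|.
  have /cvgrPdist_lt/(_ _ k2)/nbhs_ballP[d /= d0 dk] := ck 0.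
  exists d => // x xd.
  have {}dk : `|k 0 - k x| < `|k 0| / 2.
    by apply: dk; rewrite /ball/= sub0r normrN.
  have := ler_normD (k 0 - k x) (k x); rewrite subrK.
  by move: dk; lra.
apply: (@not_integrable_inv _ (c * (`|k 0| / 2)) (Num.min d 1) _ _ _ fi).
- by rewrite mulr_gt0.
- by rewrite lt_min d0/=.
move=> x x0; rewrite lt_min => /andP[xd x1].
have Tx := cT x x0 x1.
have T0 : 0 <= T x by rewrite (le_trans _ Tx)// divr_ge0 ?(ltW c0) ?(ltW x0).
apply: (@le_trans _ _ (`|T x * k x|)).
  rewrite normrM (ger0_norm T0) mulrAC ler_pM ?(ltW k2) ?divr_ge0 ?(ltW c0) ?(ltW x0)//.
  by apply: dk; rewrite gtr0_norm.
have [u [v [u1 v1 ->]]] := kuv x x0.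
rewrite (le_trans (ler_normD _ _))// lerD//=.
  rewrite normrM E0// E1// [leRHS](_ : _ = `|T x * (g x * cos (b x) - h x * sin (b x))|).
    by rewrite ler_piMl.
  by congr (`|_|); rewrite /S; ring.
rewrite normrM E0// E1// [leRHS](_ : _ = `|T x * (h x * cos (b x) + g x * sin (b x))|).
  by rewrite ler_piMl.
by congr (`|_|); rewrite /S; ring.
Qed.

End NonIntegrability.

(** * Complex series and two-sided sums *)

Section ComplexParts.
Set Implicit Arguments.
Unset Strict Implicit.
Context {R : realType}.
Implicit Types (x y z : R[i]) (t : R).

Lemma ReM x y : complex.Re (x * y) =
  complex.Re x * complex.Re y - complex.Im x * complex.Im y.
Proof. by case: x y => [a b] [c d]. Qed.

Lemma ImM x y : complex.Im (x * y) =
  complex.Re x * complex.Im y + complex.Im x * complex.Re y.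
Proof. by case: x y => [a b] [c d]. Qed.

Lemma complex_eqP x y : complex.Re x = complex.Re y -> complex.Im x = complex.Im y -> x = y.
Proof. by case: x y => [a b] [c d] /= -> ->. Qed.

(** Convergence in [R[i]] is componentwise. *)
Lemma complex_cvg (T : Type) (F : set_system T) (FF : Filter F) (u : T -> R[i]) (a b : R) :
  complex.Re (u x) @[x --> F] --> a -> complex.Im (u x) @[x --> F] --> b ->
  (u x : R[i]^o) @[x --> F] --> (a +i* b : R[i]^o).
Proof.
move=> ua ub; apply/cvgrPdist_lt => e e0.
have [eI eR] : complex.Im e = 0 /\ 0 < complex.Re e.
  by move: e0; rewrite ltcE/= => /andP[/eqP -> ->].
have e2 : 0 < complex.Re e / 2 by rewrite divr_gt0.
near=> x.
have h1 : `|a - complex.Re (u x)| < complex.Re e / 2.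
  by near: x; exact: ((cvgrPdist_lt _ _).1 ua).
have h2 : `|b - complex.Im (u x)| < complex.Re e / 2.
  by near: x; exact: ((cvgrPdist_lt _ _).1 ub).
move: (u x) h1 h2 => [c d] /= h1 h2.
rewrite normc_def ltcE/= eI eqxx/=.
set p := a - c in h1 *; set q := b - d in h2 *.
apply: (@le_lt_trans _ _ (`|p| + `|q|)); last by move: h1 h2; lra.
rewrite -[leRHS]ger0_norm ?addr_ge0// -sqrtr_sqr ler_wsqrtr//.
rewrite [leRHS]sqrrD !real_normK ?num_real//.
by rewrite -addrA lerD2l lerDr mulrn_wge0// mulr_ge0.
Unshelve. all: by end_near. Qed.

Lemma Re_sum (u : nat -> R[i]) N :
  complex.Re (\sum_(0 <= n < N) u n) = series (fun n => complex.Re (u n)) N.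
Proof. by rewrite raddf_sum. Qed.

Lemma Im_sum (u : nat -> R[i]) N :
  complex.Im (\sum_(0 <= n < N) u n) = series (fun n => complex.Im (u n)) N.
Proof. by rewrite raddf_sum. Qed.

Lemma complex_series_lim (u : nat -> R[i]) :
  cvgn (series (fun n => complex.Re (u n))) -> cvgn (series (fun n => complex.Im (u n))) ->
  lim ((\sum_(0 <= n < N) u n : R[i]^o) @[N --> \oo]) =
  limn (series (fun n => complex.Re (u n))) +i* limn (series (fun n => complex.Im (u n))).
Proof.
move=> cr ci; apply: cvg_lim; first exact: norm_hausdorff.
apply: complex_cvg.
  by rewrite (_ : (fun n => _) = series (fun n => complex.Re (u n)))//;
    apply/funext => n; rewrite Re_sum.
by rewrite (_ : (fun n => _) = series (fun n => complex.Im (u n)))//;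
    apply/funext => n; rewrite Im_sum.
Qed.

Lemma Re_cexp z : complex.Re (cexp z) = expR (complex.Re z) * cos (complex.Im z).
Proof. by rewrite /cexp ReM/= mul0r subr0. Qed.

Lemma Im_cexp z : complex.Im (cexp z) = expR (complex.Re z) * sin (complex.Im z).
Proof. by rewrite /cexp ImM/= mul0r addr0. Qed.

Lemma cexp_imaginary t : cexp ('i%C * t%:C) = cos t +i* sin t.
Proof.
have E : cexp (R:=R) (0 +i* t) = cos t +i* sin t.
  by apply: complex_eqP; rewrite (Re_cexp, Im_cexp)/= expR0 mul1r.
rewrite -E; congr cexp; apply: complex_eqP; rewrite (ReM, ImM)/=; ring.
Qed.

Lemma cexp_imaginaryN t : cexp (- ('i%C * t%:C)) = cos t -i* sin t.
Proof.
by rewrite -mulrN -raddfN/= cexp_imaginary cosN sinN.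
Qed.

Implicit Types (r xi zeta : R).

(** A two-sided series whose coefficients depend on the modulus of the index
folds into a one-sided series with real weights. *)
Lemma sumZ_weight (c : nat -> R[i]) (M : nat -> R) xi : cvgn (series M) ->
  (forall n, `|complex.Re (c n)| <= M n) -> (forall n, `|complex.Im (c n)| <= M n) ->
  sumZ (fun m : int => c `|m|%N * cexp ('i%C * (2 * pi * m%:~R * xi)%:C)) =
  limn (series (fun n => weight xi n * complex.Re (c n))) +i*
  limn (series (fun n => weight xi n * complex.Im (c n))).
Proof.
move=> cM reM imM.
pose C n := cos (2 * pi * n%:R * xi); pose S n := sin (2 * pi * n%:R * xi).
have S0 : S 0%N = 0 by rewrite /S mulr0 mul0r sin0.
have C0 : C 0%N = 1 by rewrite /C mulr0 mul0r cos0.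
have C1 n : `|C n| <= 1 by exact: cos_max.
have S1 n : `|S n| <= 1 by exact: sin_max.
have cvg_mul (p q : nat -> R) : (forall n, `|p n| <= M n) -> (forall n, `|q n| <= 1) ->
    cvgn (series (fun n => p n * q n)).
  move=> pM q1; apply: (summable_dominated cM) => n.
  by rewrite normrM -[leRHS]mulr1 ler_pM.
have shift (p : nat -> R) : cvgn (series p) ->
    series (fun n => p n.+1) m @[m --> \oo] --> limn (series p) - p 0%N.
  move=> cp; have -> : (fun m => series (fun n => p n.+1) m) = (fun m => series p m.+1 - p 0%N).
    apply/funext => m; rewrite /series/= [in RHS]big_nat_recl// addrC addKr.
    by rewrite !big_mkord.
  apply: cvgB; last exact: cvg_cst.
  by rewrite (cvg_shiftS (series p)).
(* The identity of the real parts; the imaginary parts follow by taking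
   p := Im c and q := - Re c. *)
have weighted (p q : nat -> R) : (forall n, `|p n| <= M n) -> (forall n, `|q n| <= M n) ->
    limn (series (fun n => p n * C n - q n * S n)) +
    limn (series (fun n => p n.+1 * C n.+1 + q n.+1 * S n.+1)) =
    limn (series (fun n => weight xi n * p n)).
  move=> pM qM.
  have cA := cvg_mul p C pM C1; have cB := cvg_mul q S qM S1.
  have -> : limn (series (fun n => p n * C n - q n * S n)) =
      limn (series (fun n => p n * C n)) - limn (series (fun n => q n * S n)).
    apply: cvg_lim => //; rewrite (_ : series _ = fun m =>
      series (fun n => p n * C n) m - series (fun n => q n * S n) m).
      exact: cvgB.
    by apply/funext => m; rewrite /series/= sumrB.
  have -> : limn (series (fun n => p n.+1 * C n.+1 + q n.+1 * S n.+1)) =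
      (limn (series (fun n => p n * C n)) - p 0%N * C 0%N) +
      (limn (series (fun n => q n * S n)) - q 0%N * S 0%N).
    apply: cvg_lim => //; rewrite (_ : series _ = fun m =>
      series (fun n => p n.+1 * C n.+1) m + series (fun n => q n.+1 * S n.+1) m).
      by apply: cvgD; exact: (shift (fun n => _ n * _ n)).
    by apply/funext => m; rewrite /series/= big_split.
  rewrite S0 mulr0 subr0; apply/esym/cvg_lim => //.
  rewrite -(cvg_shiftS (series _)).
  rewrite (_ : _ - _ + _ = 2 * limn (series (fun n => p n * C n)) - p 0%N * C 0%N); last by ring.
  rewrite (_ : [sequence _]_n = (fun m => 2 * series (fun n => p n * C n) m.+1 - p 0%N * C 0%N)).
    apply: cvgB; last exact: cvg_cst.
    by apply: cvgMr; rewrite (cvg_shiftS (series _)).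
  apply/funext => m; rewrite /series/= !(@big_nat_recl _ _ _ m)//.
  rewrite mulrDr big_distrr/= {1}/weight/= C0.
  under eq_bigr do rewrite /weight/= -mulrA (mulrC (cos _)).
  by rewrite /C mul1r mulr1; ring.
pose a (m : int) := c `|m|%N * cexp ('i%C * (2 * pi * m%:~R * xi)%:C).
have Rp n : complex.Re (a n%:Z) = complex.Re (c n) * C n - complex.Im (c n) * S n.
  by rewrite /a cexp_imaginary ReM.
have Ip n : complex.Im (a n%:Z) = complex.Im (c n) * C n - - complex.Re (c n) * S n.
  by rewrite /a cexp_imaginary ImM/= mulNr opprK addrC.
have Rn n : complex.Re (a (- n.+1%:Z)) =
    complex.Re (c n.+1) * C n.+1 + complex.Im (c n.+1) * S n.+1.
  rewrite /a abszN absz_nat mulrNz mulrN mulNr cexp_imaginary ReM/= cosN sinN.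
  by rewrite mulrN opprK.
have In n : complex.Im (a (- n.+1%:Z)) =
    complex.Im (c n.+1) * C n.+1 + - complex.Re (c n.+1) * S n.+1.
  rewrite /a abszN absz_nat mulrNz mulrN mulNr cexp_imaginary ImM/= cosN sinN.
  by rewrite mulrN mulNr addrC.
have imNM n : `|- complex.Re (c n)| <= M n by rewrite normrN.
have cvg1 (p q : nat -> R) : (forall n, `|p n| <= M n) -> (forall n, `|q n| <= M n) ->
    cvgn (series (fun n => p n * C n - q n * S n)).
  move=> pM qM; rewrite (_ : series _ = fun m =>
      series (fun n => p n * C n) m - series (fun n => q n * S n) m).
    by apply: is_cvgB; exact: cvg_mul.
  by apply/funext => m; rewrite /series/= sumrB.
have cvg2 (p q : nat -> R) : (forall n, `|p n| <= M n) -> (forall n, `|q n| <= M n) ->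
    cvgn (series (fun n => p n.+1 * C n.+1 + q n.+1 * S n.+1)).
  move=> pM qM; rewrite (_ : series _ = fun m =>
      series (fun n => p n.+1 * C n.+1) m + series (fun n => q n.+1 * S n.+1) m).
    by apply: is_cvgD; apply/cvg_ex; eexists; apply: (shift (fun n => _ n * _ n)); exact: cvg_mul.
  by apply/funext => m; rewrite /series/= big_split.
rewrite /sumZ -/a.
have fRp : (fun n : nat => complex.Re (a n%:Z)) = _ := funext Rp.
have fIp : (fun n : nat => complex.Im (a n%:Z)) = _ := funext Ip.
have fRn : (fun n : nat => complex.Re (a (- n.+1%:Z))) = _ := funext Rn.
have fIn : (fun n : nat => complex.Im (a (- n.+1%:Z))) = _ := funext In.
rewrite (@complex_series_lim (fun n => a n%:Z)); first last.
  by rewrite fIp; exact: (cvg1 (fun n => complex.Im (c n)) (fun n => - complex.Re (c n))).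
  by rewrite fRp; exact: (cvg1 (fun n => complex.Re (c n)) (fun n => complex.Im (c n))).
rewrite (@complex_series_lim (fun n => a (- n.+1%:Z))); first last.
  by rewrite fIn; exact: (cvg2 (fun n => complex.Im (c n)) (fun n => - complex.Re (c n))).
  by rewrite fRn; exact: (cvg2 (fun n => complex.Re (c n)) (fun n => complex.Im (c n))).
rewrite fRp fIp fRn fIn.
apply: complex_eqP => /=.
  exact: (weighted (fun n => complex.Re (c n)) (fun n => complex.Im (c n))).
exact: (weighted (fun n => complex.Im (c n)) (fun n => - complex.Re (c n))).
Qed.

End ComplexParts.

(** * The pairings on the positive half line *)

Section Pairings.
Set Implicit Arguments.
Unset Strict Implicit.
Context {R : realType}.
Implicit Types (r xi zeta : R) (phi : R -> R[i]).
Notation mu := (@lebesgue_measure R).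

Lemma sqr_intr_absz (n : int) : (n%:~R : R) ^+ 2 = `|n|%N%:R ^+ 2.
Proof. by case: n => k //=; rewrite NegzE mulrNz sqrrN. Qed.

Lemma norm_damped_le (a b : R) : `|b| <= 1 -> `|expR a * b| <= 2 * expR a.
Proof.
move=> b1; rewrite normrM (ger0_norm (expR_ge0 _)) mulrC ler_wpM2r ?expR_ge0//.
by rewrite (le_trans b1)// ler1n.
Qed.

(** The polar form of the terms of the series in [w], before multiplication by
[exp (- 2 pi i r ^ 2 zeta)]; this covers both signs under the square root. *)
Lemma propagator_polar r zeta (n : int) : 0 < r ->
  cexp ('i%C * (2 * pi * r ^+ 2)%:C * csqrt (1 - (n%:~R / r) ^+ 2) * zeta%:C) =
  (expR (- (damp r `|n| * zeta)) * cos ((freq r `|n| + 2 * pi * r ^+ 2) * zeta)) +i*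
  (expR (- (damp r `|n| * zeta)) * sin ((freq r `|n| + 2 * pi * r ^+ 2) * zeta)).
Proof.
move=> r0; have -> : (n%:~R / r) ^+ 2 = (`|n|%N%:R / r) ^+ 2 :> R.
  by rewrite !expr_div_n sqr_intr_absz.
set c := 2 * pi * r ^+ 2.
have Rez (z : R[i]) : complex.Re ('i%C * c%:C * z * zeta%:C) = - (c * complex.Im z * zeta).
  by rewrite !(ReM, ImM)/=; ring.
have Imz (z : R[i]) : complex.Im ('i%C * c%:C * z * zeta%:C) = c * complex.Re z * zeta.
  by rewrite !(ReM, ImM)/=; ring.
have [nr|rn] := leP (`|n|%N%:R) r.
  have y1 : 0 <= 1 - (`|n|%N%:R / r) ^+ 2.
    by rewrite subr_ge0 expr_le1// ?divr_ge0 ?(ltW r0)// ler_pdivrMr// mul1r.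
  apply: complex_eqP; rewrite (Re_cexp, Im_cexp) Rez Imz /csqrt y1 /= damp_low// /freq nr.
    by rewrite mulr0 mul0r; congr (_ * cos _); rewrite -/c; ring.
  by rewrite mulr0 mul0r; congr (_ * sin _); rewrite -/c; ring.
have y1 : (0 <= 1 - (`|n|%N%:R / r) ^+ 2) = false.
  apply/negbTE; rewrite -ltNge subr_lt0 exprn_egt1// ltr_pdivlMr// mul1r//.
have dE : damp r `|n| = c * Num.sqrt ((`|n|%N%:R / r) ^+ 2 - 1) by rewrite /damp leNgt rn.
apply: complex_eqP; rewrite (Re_cexp, Im_cexp) Rez Imz /csqrt y1 opprB (ReM, ImM) ?(ReM, ImM)/=;
  rewrite freq_high// dE -/c addNr.
- by congr (expR _ * cos _); ring.
- by congr (expR _ * sin _); ring.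
Qed.

Lemma w_wave r xi zeta : 0 < r -> 0 < zeta ->
  w r xi zeta = wave r xi 0 zeta +i* wave r xi (- (pi / 2)) zeta.
Proof.
move=> r0 z0; set c := 2 * pi * r ^+ 2.
pose P n : R[i] := (expR (- (damp r n * zeta)) * cos ((freq r n + c) * zeta)) +i*
  (expR (- (damp r n * zeta)) * sin ((freq r n + c) * zeta)).
have P1 n : `|complex.Re (P n)| <= 2 * expR (- (damp r n * zeta)).
  by apply: norm_damped_le; exact: cos_max.
have P2 n : `|complex.Im (P n)| <= 2 * expR (- (damp r n * zeta)).
  by apply: norm_damped_le; exact: sin_max.
have cM := summable_damp r0 z0.
rewrite /w (_ : (fun n : int => _) =
    (fun m : int => P `|m|%N * cexp ('i%C * (2 * pi * m%:~R * xi)%:C))); last first.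
  by apply/funext => n; rewrite propagator_polar.
rewrite (sumZ_weight xi cM P1 P2) cexp_imaginaryN -/c.
set X := limn _; set Y := limn _.
have cX := summable_weight (xi := xi) cM P1.
have cY := summable_weight (xi := xi) cM P2.
have comb (a b th : R) :
    (forall n, a * complex.Re (P n) + b * complex.Im (P n) = mode r n th zeta) ->
    a * X + b * Y = wave r xi th zeta.
  move=> E; apply/esym/cvg_lim => //.
  rewrite (_ : series _ = fun m => a * series (fun n => weight xi n * complex.Re (P n)) m +
     b * series (fun n => weight xi n * complex.Im (P n)) m).
    by apply: cvgD; apply: cvgMr.
  apply/funext => m; rewrite /series/= !big_distrr -big_split/=; apply: eq_bigr => n _.
  by rewrite -E /=; ring.
apply: complex_eqP; rewrite (ReM, ImM)/=.
  rewrite mulNr opprK; apply: comb => n; rewrite /mode /osc /=.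
  rewrite (_ : freq r n * zeta + 0 = (freq r n + c) * zeta - c * zeta); last by ring.
  by rewrite cosB; ring.
rewrite addrC; apply: comb => n; rewrite /mode /osc /=.
rewrite (_ : freq r n * zeta + - (pi / 2) =
  (freq r n + c) * zeta - c * zeta - pi / 2); last by ring.
by rewrite cosBpihalf sinB; ring.
Qed.

Section FixedTestFunction.
Variables (phi : R -> R[i]) (g' h' : R -> R).
Let g x := complex.Re (phi x).
Let h x := complex.Im (phi x).
Hypotheses (gg' : C1_decay g g') (hh' : C1_decay h h').

Let re_w r xi x := g x * wave r xi 0 x - h x * wave r xi (- (pi / 2)) x.
Let im_w r xi x := h x * wave r xi 0 x + g x * wave r xi (- (pi / 2)) x.

Let re_w_posE r xi : 0 < r -> (fun x => complex.Re (w_pos r xi x * phi x)) =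
  (fun x => re_w r xi x * \1_(`]0, +oo[) x).
Proof.
move=> r0; apply/funext => x; rewrite /w_pos indic_halfE.
have [x0|x0] := ltP 0 x; last by rewrite !(ReM, ImM)/=; ring.
by rewrite w_wave// !(ReM, ImM)/= /re_w /g /h; ring.
Qed.

Let im_w_posE r xi : 0 < r -> (fun x => complex.Im (w_pos r xi x * phi x)) =
  (fun x => im_w r xi x * \1_(`]0, +oo[) x).
Proof.
move=> r0; apply/funext => x; rewrite /w_pos indic_halfE.
have [x0|x0] := ltP 0 x; last by rewrite !(ReM, ImM)/=; ring.
by rewrite w_wave// !(ReM, ImM)/= /im_w /g /h; ring.
Qed.

Lemma pairable_posP r xi : 0 < r -> pairable (w_pos r xi) phi <->
  mu.-integrable `]0, +oo[ (EFin \o re_w r xi) /\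
  mu.-integrable `]0, +oo[ (EFin \o im_w r xi).
Proof.
move=> r0; rewrite /pairable /cintegrable.
have := integrable_halfP (re_w r xi); have := integrable_halfP (im_w r xi).
by rewrite -re_w_posE// -im_w_posE// => <- <-.
Qed.

Lemma pairing_posE r xi : 0 < r -> pairing (w_pos r xi) phi =
  (\int[mu]_(x in `]0, +oo[) re_w r xi x) +i* (\int[mu]_(x in `]0, +oo[) im_w r xi x).
Proof.
move=> r0; rewrite /pairing /cintegral.
by rewrite !Rintegral_halfE -re_w_posE// -im_w_posE.
Qed.

(** The pairing of [phi] with [exp (- i pi n ^ 2 zeta)] on the positive half line. *)
Definition v_coef (n : nat) : R[i] := cintegral `]0, +oo[
  (fun zeta => phi zeta * cexp (- ('i%C * (pi * n%:R ^+ 2 * zeta)%:C))).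

Let gi := C1_decay_integrable gg'.
Let hi := C1_decay_integrable hh'.

Let integrable_limit (k : R -> R) n th : mu.-integrable `]0, +oo[ (EFin \o k) ->
  mu.-integrable `]0, +oo[
    (EFin \o (fun x => k x * osc 0 (- (pi * n%:R ^+ 2)) th x)).
Proof. by apply: integrable_mul_osc. Qed.

Let osc_cos n (x : R) : osc 0 (- (pi * n%:R ^+ 2)) 0 x = cos (pi * n%:R ^+ 2 * x).
Proof. by rewrite /osc mul0r oppr0 expR0 mul1r addr0 mulNr cosN. Qed.

Let osc_sin n (x : R) : osc 0 (- (pi * n%:R ^+ 2)) (- (pi / 2)) x = - sin (pi * n%:R ^+ 2 * x).
Proof. by rewrite /osc mul0r oppr0 expR0 mul1r cosBpihalf mulNr sinN. Qed.

Let v_integrand n (x : R) : phi x * cexp (- ('i%C * (pi * n%:R ^+ 2 * x)%:C)) =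
  (g x * osc 0 (- (pi * n%:R ^+ 2)) 0 x -
   h x * osc 0 (- (pi * n%:R ^+ 2)) (- (pi / 2)) x) +i*
  (h x * osc 0 (- (pi * n%:R ^+ 2)) 0 x +
   g x * osc 0 (- (pi * n%:R ^+ 2)) (- (pi / 2)) x).
Proof.
rewrite cexp_imaginaryN osc_cos osc_sin.
by apply: complex_eqP; rewrite (ReM, ImM)/= /g /h; ring.
Qed.

Lemma v_coefE n : v_coef n =
  (limit_integral g n 0 - limit_integral h n (- (pi / 2))) +i*
  (limit_integral h n 0 + limit_integral g n (- (pi / 2))).
Proof.
rewrite /v_coef /cintegral; congr (_ +i* _).
- rewrite -RintegralB//; [|exact: integrable_limit|exact: integrable_limit].
  by apply: eq_Rintegral => x _; rewrite v_integrand.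
- rewrite -RintegralD//; [|exact: integrable_limit|exact: integrable_limit].
  by apply: eq_Rintegral => x _; rewrite v_integrand.
Qed.

Lemma v_integrable n : cintegrable `]0, +oo[
  (fun zeta => phi zeta * cexp (- ('i%C * (pi * n%:R ^+ 2 * zeta)%:C))).
Proof.
have -> : (fun zeta => phi zeta * cexp (- ('i%C * (pi * n%:R ^+ 2 * zeta)%:C))) = _ :=
  funext (v_integrand n).
split => /=.
  by apply: integrable_sub; rewrite //; exact: integrable_limit.
by apply: integrable_add; rewrite //; exact: integrable_limit.
Qed.

Lemma v_coef_dominated : exists M : nat -> R, [/\ cvgn (series M),
  forall n, `|complex.Re (v_coef n)| <= M n & forall n, `|complex.Im (v_coef n)| <= M n].
Proof.
have [Cg [_ gC]] := mode_integral_dominated gg'.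
have [Ch [_ hC]] := mode_integral_dominated hh'.
exists (fun n => (Cg + Ch) * (1 + n%:R ^+ 2)^-1); split.
- exact: summable_inv_sqr.
- move=> n; rewrite v_coefE /= [leRHS]mulrDl (le_trans (ler_normB _ _))//.
  by rewrite lerD.
- move=> n; rewrite v_coefE /= [leRHS]mulrDl (le_trans (ler_normD _ _))// addrC.
  by rewrite lerD.
Qed.

(** The pairing of a real function with the real ([th = 0]) or imaginary
([th = - pi / 2]) part of [v]. *)
Definition v_lim xi (k : R -> R) th : R :=
  limn (series (fun n => weight xi n * limit_integral k n th)).

Lemma v_posE xi : v_pos xi phi =
  (v_lim xi g 0 - v_lim xi h (- (pi / 2))) +i*
  (v_lim xi h 0 + v_lim xi g (- (pi / 2))).
Proof.
have [M [cM reM imM]] := v_coef_dominated.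
have sum k k' th := @summable_limit_integral R k k' xi th.
rewrite /v_pos (_ : (fun n : int => _) =
    (fun m : int => v_coef `|m|%N * cexp ('i%C * (2 * pi * m%:~R * xi)%:C))); last first.
  apply/funext => n; rewrite mulrC; congr (_ * _); rewrite /v_coef.
  by rewrite sqr_intr_absz.
have Ev := funext v_coefE.
rewrite (sumZ_weight xi cM reM imM) Ev; congr (_ +i* _); apply: cvg_lim => //.
- rewrite (_ : series _ = fun m =>
     series (fun n => weight xi n * limit_integral g n 0) m -
     series (fun n => weight xi n * limit_integral h n (- (pi / 2))) m).
    by apply: cvgB; [exact: (sum _ g')|exact: (sum _ h')].
  by apply/funext => m; rewrite /series/= -sumrB; apply: eq_bigr => n _; rewrite mulrBr.
- rewrite (_ : series _ = fun m =>
     series (fun n => weight xi n * limit_integral h n 0) m +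
     series (fun n => weight xi n * limit_integral g n (- (pi / 2))) m).
    by apply: cvgD; [exact: (sum _ h')|exact: (sum _ g')].
  by apply/funext => m; rewrite /series/= -big_split; apply: eq_bigr => n _; rewrite mulrDr.
Qed.

Let vanish xi : (xi \isn't a Num.int) \/ phi 0 = 0 ->
  ((xi \isn't a Num.int) \/ g 0 = 0) /\ ((xi \isn't a Num.int) \/ h 0 = 0).
Proof. by case=> [?|e]; split; [left|left|right|right]; rewrite // /g /h e. Qed.

Lemma pairable_pos r xi : (xi \isn't a Num.int) \/ phi 0 = 0 -> 0 < r ->
  pairable (w_pos r xi) phi.
Proof.
move=> /vanish[xig xih] r0; apply/pairable_posP => //.
have G th := (wave_integral th gg' r0 xig).1.
have H th := (wave_integral th hh' r0 xih).1.
by split; [apply: integrable_sub|apply: integrable_add].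
Qed.

(** The converse of [pairable_pos]; thus a pairing that makes sense is always
covered by the convergence theorem for the wave. *)
Lemma pairable_pos_vanishing r xi : 0 < r -> pairable (w_pos r xi) phi ->
  (xi \isn't a Num.int) \/ phi 0 = 0.
Proof.
move=> r0 /pairable_posP-/(_ r0)[A B].
have [xiZ|] := boolP (xi \is a Num.int); last by left.
right; apply/eqP; apply: contrapT => /negP phi0.
apply: (wave_not_integrable gg' hh' r0 xiZ _ A B).
rewrite -negb_and; apply: contra phi0 => /andP[/eqP a /eqP b].
by apply/eqP/complex_eqP.
Qed.

Lemma pairing_pos_cvg xi : (\forall r \near +oo, pairable (w_pos r xi) phi) ->
  (pairing (w_pos r xi) phi : R[i]^o) @[r --> +oo] --> (v_pos xi phi : R[i]^o).
Proof.
move=> near_pair.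
have : \forall r \near +oo, 0 < r /\ pairable (w_pos r xi) phi.
  by near=> r; split; near: r => //; exact: nbhs_pinfty_gt.
move=> /filter_ex[r1 [r10 /(pairable_pos_vanishing r10)/vanish[xig xih]]].
have E : {near +oo, (fun r =>
    (\int[mu]_(x in `]0, +oo[) re_w r xi x) +i* (\int[mu]_(x in `]0, +oo[) im_w r xi x) : R[i]^o)
    =1 (fun r => pairing (w_pos r xi) phi : R[i]^o)}.
  by near=> r; rewrite pairing_posE.
have G th := wave_integral_cvg (th := th) gg' xig.
have H th := wave_integral_cvg (th := th) hh' xih.
suff : ((\int[mu]_(x in `]0, +oo[) re_w r xi x) +i*
   (\int[mu]_(x in `]0, +oo[) im_w r xi x) : R[i]^o) @[r --> +oo] --> (v_pos xi phi : R[i]^o).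
  by apply: cvg_trans; exact: near_eq_cvg E.
rewrite v_posE; apply: complex_cvg => /=.
  have E2 : {near +oo, (fun r => \int[mu]_(x in `]0, +oo[) (g x * wave r xi 0 x) -
      \int[mu]_(x in `]0, +oo[) (h x * wave r xi (- (pi / 2)) x))
      =1 (fun r => \int[mu]_(x in `]0, +oo[) re_w r xi x)}.
    near=> r; have r0 : 0 < r by near: r; exact: nbhs_pinfty_gt.
    rewrite -RintegralB//; [exact: (wave_integral _ gg' r0 xig).1|].
    exact: (wave_integral _ hh' r0 xih).1.
  apply: (cvg_trans (near_eq_cvg E2)).
  exact: cvgB (G 0) (H (- (pi / 2))).
have E2 : {near +oo, (fun r => \int[mu]_(x in `]0, +oo[) (h x * wave r xi 0 x) +
    \int[mu]_(x in `]0, +oo[) (g x * wave r xi (- (pi / 2)) x))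
    =1 (fun r => \int[mu]_(x in `]0, +oo[) im_w r xi x)}.
  near=> r; have r0 : 0 < r by near: r; exact: nbhs_pinfty_gt.
  rewrite -RintegralD//; [exact: (wave_integral _ hh' r0 xih).1|].
  exact: (wave_integral _ gg' r0 xig).1.
apply: (cvg_trans (near_eq_cvg E2)).
exact: cvgD (H 0) (G (- (pi / 2))).
Unshelve. all: by end_near. Qed.

End FixedTestFunction.

End Pairings.

(** * The even extension *)

Section EvenExtension.
Set Implicit Arguments.
Unset Strict Implicit.
Context {R : realType}.
Implicit Types (r xi x : R).
Notation mu := (@lebesgue_measure R).

(** Additivity of the two-sided sum for dominated coefficients. *)
Lemma sumZ_weight_add (c1 c2 : nat -> R[i]) (M1 M2 : nat -> R) xi :
  cvgn (series M1) -> cvgn (series M2) ->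
  (forall n, `|complex.Re (c1 n)| <= M1 n) -> (forall n, `|complex.Im (c1 n)| <= M1 n) ->
  (forall n, `|complex.Re (c2 n)| <= M2 n) -> (forall n, `|complex.Im (c2 n)| <= M2 n) ->
  sumZ (fun m : int => (c1 `|m|%N + c2 `|m|%N) * cexp ('i%C * (2 * pi * m%:~R * xi)%:C)) =
  sumZ (fun m : int => c1 `|m|%N * cexp ('i%C * (2 * pi * m%:~R * xi)%:C)) +
  sumZ (fun m : int => c2 `|m|%N * cexp ('i%C * (2 * pi * m%:~R * xi)%:C)).
Proof.
move=> cM1 cM2 re1 im1 re2 im2.
have add (p q : nat -> R) : (forall n, `|p n| <= M1 n) -> (forall n, `|q n| <= M2 n) ->
    limn (series (fun n => weight xi n * (p n + q n))) =
    limn (series (fun n => weight xi n * p n)) + limn (series (fun n => weight xi n * q n)).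
  move=> pM qM; apply: cvg_lim => //.
  rewrite (_ : series _ = fun m => series (fun n => weight xi n * p n) m +
      series (fun n => weight xi n * q n) m).
    by apply: cvgD; [exact: summable_weight pM|exact: summable_weight qM].
  apply/funext => m; rewrite /series/= -big_split; apply: eq_bigr => n _.
  by rewrite mulrDr.
have cM : cvgn (series (fun n => M1 n + M2 n)).
  rewrite (_ : series _ = fun m => series M1 m + series M2 m); first exact: is_cvgD.
  by apply/funext => m; rewrite /series/= big_split.
have ReD (z1 z2 : R[i]) : complex.Re (z1 + z2) = complex.Re z1 + complex.Re z2 by exact: raddfD.
have ImD (z1 z2 : R[i]) : complex.Im (z1 + z2) = complex.Im z1 + complex.Im z2 by exact: raddfD.
rewrite (@sumZ_weight _ (fun n => c1 n + c2 n) _ xi cM).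
- rewrite (sumZ_weight xi cM1 re1 im1) (sumZ_weight xi cM2 re2 im2).
  apply: complex_eqP => /=; rewrite -add//; congr (limn (series _)).
    by apply/funext => n; rewrite ReD.
  by apply/funext => n; rewrite ImD.
- by move=> n; rewrite ReD (le_trans (ler_normD _ _))// lerD.
- by move=> n; rewrite ImD (le_trans (ler_normD _ _))// lerD.
Qed.

Section FixedTestFunction.
Variables (phi : R -> R[i]) (g' h' : R -> R).
Hypotheses (gg' : C1_decay (fun x => complex.Re (phi x)) g')
           (hh' : C1_decay (fun x => complex.Im (phi x)) h').
Let psi x := phi (- x).
Let gg'N := C1_decay_reflect gg'.
Let hh'N := C1_decay_reflect hh'.

Let even_split r xi (k : R[i] -> R) : k 0 = 0 ->
  (fun x => k (w_pos r xi x * phi x)) =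
    (fun x => k (w_even r xi x * phi x) * \1_(`]0, +oo[) x) /\
  (fun x => k (w_pos r xi x * psi x)) =
    (fun x => k (w_even r xi (- x) * phi (- x)) * \1_(`]0, +oo[) x).
Proof.
have C1 : (1 : R)%:C = 1 by []; have C0 : (0 : R)%:C = 0 by [].
by move=> k0; split; apply/funext => x; rewrite /w_pos /w_even ?normrN indic_halfE;
  (have [x0|x0] := ltP 0 x; [rewrite gtr0_norm//= C1 !mulr1|rewrite /= C0 !mulr0 mul0r]).
Qed.

Lemma pairable_evenP r xi : pairable (w_even r xi) phi <->
  pairable (w_pos r xi) phi /\ pairable (w_pos r xi) psi.
Proof.
have [e1 e2] := even_split r xi (k := @complex.Re R) erefl.
have [e3 e4] := even_split r xi (k := @complex.Im R) erefl.
rewrite /pairable /cintegrable.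
have := integrable_splitP (fun x => complex.Re (w_even r xi x * phi x)).
have := integrable_splitP (fun x => complex.Im (w_even r xi x * phi x)).
rewrite !integrable_halfP -e1 -e2 -e3 -e4 => -> ->.
by split=> [[[? ?] [? ?]]|[[? ?] [? ?]]].
Qed.

Lemma pairing_evenE r xi : pairable (w_even r xi) phi ->
  pairing (w_even r xi) phi = pairing (w_pos r xi) phi + pairing (w_pos r xi) psi.
Proof.
have [e1 e2] := even_split r xi (k := @complex.Re R) erefl.
have [e3 e4] := even_split r xi (k := @complex.Im R) erefl.
move=> [rei imi]; rewrite /pairing /cintegral.
rewrite (Rintegral_split rei) (Rintegral_split imi) !Rintegral_halfE.
by rewrite e1 e2 e3 e4; apply: complex_eqP.
Qed.

Let v_even_coef n : cintegral setT
    (fun zeta => phi zeta * cexp (- ('i%C * (pi * n%:R ^+ 2 * `|zeta|)%:C))) =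
  v_coef phi n + v_coef psi n.
Proof.
pose K x := phi x * cexp (- ('i%C * (pi * n%:R ^+ 2 * `|x|)%:C)).
pose P x := phi x * cexp (- ('i%C * (pi * n%:R ^+ 2 * x)%:C)).
pose Q x := psi x * cexp (- ('i%C * (pi * n%:R ^+ 2 * x)%:C)).
have [Pr Pi] : cintegrable `]0, +oo[ P := v_integrable gg' hh' n.
have [Qr Qi] : cintegrable `]0, +oo[ Q := v_integrable gg'N hh'N n.
have KP x : 0 < x -> K x = P x by move=> x0; rewrite /K gtr0_norm.
have KQ x : 0 < x -> K (- x) = Q x by move=> x0; rewrite /K normrN gtr0_norm.
have main (k : R[i] -> R) :
    mu.-integrable `]0, +oo[ (EFin \o (fun x => k (P x))) ->
    mu.-integrable `]0, +oo[ (EFin \o (fun x => k (Q x))) ->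
    \int[mu]_x k (K x) = \int[mu]_(x in `]0, +oo[) k (P x) +
                         \int[mu]_(x in `]0, +oo[) k (Q x).
  move=> kP kQ; rewrite (Rintegral_split (f := fun x => k (K x))); last first.
    apply/integrable_splitP; split.
      apply: eq_integrable kP => //= x; rewrite inE/= in_itv/= andbT => x0.
      by rewrite KP.
    apply: eq_integrable kQ => //= x; rewrite inE/= in_itv/= andbT => x0.
    by rewrite KQ.
  congr (_ + _); apply: eq_Rintegral => x; rewrite inE/= in_itv/= andbT => x0.
    by rewrite KP.
  by rewrite KQ.
by apply: complex_eqP; exact: main.
Qed.

Lemma v_evenE xi : v_even xi phi = v_pos xi phi + v_pos xi psi.
Proof.
have [M1 [cM1 re1 im1]] := v_coef_dominated gg' hh'.
have [M2 [cM2 re2 im2]] := v_coef_dominated gg'N hh'N.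
have fold (f : R -> R[i]) : v_pos xi f = sumZ (fun m : int =>
    v_coef f `|m|%N * cexp ('i%C * (2 * pi * m%:~R * xi)%:C)).
  rewrite /v_pos; congr sumZ; apply/funext => m.
  by rewrite mulrC sqr_intr_absz.
rewrite !fold -(sumZ_weight_add xi cM1 cM2 re1 im1 re2 im2) /v_even.
congr sumZ; apply/funext => m.
by rewrite mulrC sqr_intr_absz v_even_coef.
Qed.

Lemma pairable_even r xi : (xi \isn't a Num.int) \/ phi 0 = 0 -> 0 < r ->
  pairable (w_even r xi) phi.
Proof.
move=> xiphi r0; apply/pairable_evenP; split; first exact: (pairable_pos gg' hh').
by apply: (pairable_pos gg'N hh'N) => //; rewrite oppr0.
Qed.

Lemma pairing_even_cvg xi : (\forall r \near +oo, pairable (w_even r xi) phi) ->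
  (pairing (w_even r xi) phi : R[i]^o) @[r --> +oo] --> (v_even xi phi : R[i]^o).
Proof.
move=> near_pair.
have E : {near +oo, (fun r => pairing (w_pos r xi) phi + pairing (w_pos r xi) psi : R[i]^o)
    =1 (fun r => pairing (w_even r xi) phi : R[i]^o)}.
  by near=> r; rewrite pairing_evenE//; near: r.
apply: (cvg_trans (near_eq_cvg E)); rewrite v_evenE.
apply: (@cvgD _ (R[i]^o)).
  apply: (pairing_pos_cvg gg' hh').
  by near=> r; have [] : pairable (w_pos r xi) phi /\ pairable (w_pos r xi) psi;
    [apply/pairable_evenP; near: r|].
apply: (pairing_pos_cvg gg'N hh'N).
by near=> r; have [] : pairable (w_pos r xi) phi /\ pairable (w_pos r xi) psi;
  [apply/pairable_evenP; near: r|].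
Unshelve. all: by end_near. Qed.

End FixedTestFunction.

End EvenExtension.

Theorem theorem2 (R : realType) (xi : R) (phi : R -> R[i]) :
  schwartz phi ->
  [/\ (xi \isn't a Num.int) \/ phi 0 = 0 ->
        forall r : R, 0 < r ->
          pairable (w_pos r xi) phi /\ pairable (w_even r xi) phi,
      (\forall r \near +oo, pairable (w_pos r xi) phi) ->
        (pairing (w_pos r xi) phi : R[i]^o) @[r --> +oo] --> (v_pos xi phi : R[i]^o)
    & (\forall r \near +oo, pairable (w_even r xi) phi) ->
        (pairing (w_even r xi) phi : R[i]^o) @[r --> +oo] --> (v_even xi phi : R[i]^o) ].
Proof.
move=> [/schwartzR_C1_decay gg' /schwartzR_C1_decay hh']; split.
- move=> xiphi r r0; split; first exact: (pairable_pos gg' hh').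
  exact: (pairable_even gg' hh').
- exact: (pairing_pos_cvg gg' hh').
- exact: (pairing_even_cvg gg' hh').
Qed.
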